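(* Let $n\ge 2$, $\lambda>0$, and let $P_n(\boldsymbol\theta)=\sum_{T\subset[n]}p_T\boldsymbol\theta^T$ be an affine polynomial with $p_\varnothing=1$, $p_T\ne0$ for all $T\subset[n]$, $p_{[j]}>0$ for $j=1,\dots,n$, such that the multivariate gamma distribution $\boldsymbol\gamma_{(P_n,\lambda)}$ exists and is infinitely divisible. Let $\mathbf X=(X_1,\dots,X_n)\sim\boldsymbol\gamma_{(P_n,\lambda)}$ and assume $R_n\neq0$. Write $N=[n]\setminus\{1\}=\{2,\dots,n\}$, $\boldsymbol\theta_N=(\theta_2,\dots,\theta_n)$, $S_N(\boldsymbol\theta_N)=\sum_{T\subset N}\frac{p_{\{1\}\cup T}}{p_1}\boldsymbol\theta^T$, $S_i(\theta_i)=1+(-\widetilde p_i)^{-1}\theta_i$, and for $U\subset N$, $\mathbf S^U=\prod_{i\in U}S_i(\theta_i)$ and $(-\widetilde{\mathbf p})^U=\prod_{i\in U}(-\widetilde p_i)$. Then the Laplace transform of $(X_2,\dots,X_n)$ given $X_1=x_1$ satisfies $$L_{(X_2,\dots,X_n)}^{X_1=x_1}(\boldsymbol\theta_N)=S_N(\boldsymbol\theta_N)^{-\lambda}\exp\Big\{-\Big[\frac{P_n(0,\boldsymbol\theta_N)}{S_N(\boldsymbol\theta_N)}-1\Big]\frac{x_1}{p_1}\Big\}$$ $$=S_N(\boldsymbol\theta_N)^{-\lambda}\exp\Big\{-\Big[\frac{\sum_{T\subset N}\big(p_T-\frac{p_{\{1\}\cup T}}{p_1}\big)\boldsymbol\theta^T}{S_N(\boldsymbol\theta_N)}\Big]\frac{x_1}{p_1}\Big\}$$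 $$=S_N(\boldsymbol\theta_N)^{-\lambda}\exp\Big\{\frac{p_{[n]}}{p_1}x_1\sum_{T\subset N,\,|T|>0}r_{\{1\}\cup T}\,(-\widetilde{\mathbf p})^{N\setminus T}\big[\mathbf S^{N\setminus T}S_N(\boldsymbol\theta_N)^{-1}-1\big]\Big\}.$$ Equivalently, since $p_{[n]}/p_1=(-\widetilde p_N)^{-1}$, $$L_{(X_2,\dots,X_n)}^{X_1=x_1}=S_N^{-\lambda}\exp\Big\{(-\widetilde p_N)^{-1}x_1\Big[\sum_{T\subset N,\,|T|>0}r_{\{1\}\cup T}(-\widetilde{\mathbf p})^{N\setminus T}\,\mathbf S^{N\setminus T}S_N^{-1}-C\Big]\Big\},$$ where $C=\sum_{T\subset N,\,|T|>0}r_{\{1\}\cup T}(-\widetilde{\mathbf p})^{N\setminus T}$ is such that $L_{(X_2,\dots,X_n)}^{X_1=x_1}(\mathbf 0)=1$.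
   Context: Notation: $[n]=\{1,\dots,n\}$, $\overline T=[n]\setminus T$, $\mathbf z^T=\prod_{t\in T}z_t$, $p_1=p_{\{1\}}$. An affine polynomial is a polynomial of degree at most one in each variable. The multivariate gamma distribution $\boldsymbol\gamma_{(P,\lambda)}$ is the probability distribution on $\mathbb R^n$ of a random vector $\mathbf X$ with $\mathbb E[\exp(-\sum_i\theta_iX_i)]=[P(\boldsymbol\theta)]^{-\lambda}$ for $\boldsymbol\theta$ in a set with non-empty interior; it is infinitely divisible if for every $t>0$, $[P(\boldsymbol\theta)]^{-\lambda t}$ is the Laplace transform of a positive measure. $\widetilde p_T=-p_{\overline T}/p_{[n]}$, $\widetilde p_i=\widetilde p_{\{i\}}$, $\boldsymbol\theta_{P_n}=(\widetilde p_1,\dots,\widetilde p_n)$. For $|T|\ge2$, $r_T=-\frac1{p_{[n]}}\big(\prod_{i\in\overline T}\frac{\partial}{\partial\theta_i}\big)P_n(\boldsymbol\theta_{P_n})$, and $R_n(\mathbf z)=\sum_{T\subset[n],|T|\ge2}r_T\mathbf z^T$. The conditional Laplace transform is $L_{(X_2,\dots,X_n)}^{X_1=x_1}(\boldsymbol\theta_N)=\mathbb E[\exp(-\sum_{i=2}^n\theta_iX_i)\mid X_1=x_1]$; the formulas give a version of it for $x_1>0$ and $\theta_i\ge0$. *)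

(* Defs.v *)
From HB Require Import structures.
From mathcomp Require Import all_boot all_order all_algebra.
From mathcomp Require Import all_classical all_reals all_analysis.
Set Implicit Arguments.
Unset Strict Implicit.
Unset Printing Implicit Defensive.
Import Order.TTheory GRing.Theory Num.Theory.
Import numFieldNormedType.Exports.
Local Open Scope ring_scope.

(* The index set [n] = {1, ..., n} is 'I_n, with the index j of the text
   represented by j - 1; in particular 1 is represented by the following. *)
Definition idx1 (n : nat) (hn : (2 <= n)%N) : 'I_n := Ordinal (ltnW hn).

Section AffinePolynomials.
Context {R : realType} {n : nat}.
Implicit Types (p : {set 'I_n} -> R) (T U : {set 'I_n}) (theta z : 'rV[R]_n).

Definition monom z T : R := \prod_(t in T) z 0 t.

Definition affine p theta : R := \sum_(T : {set 'I_n}) p T * monom theta T.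

Definition ptilde p T : R := - p (~: T) / p [set: 'I_n].

Definition thetaP p : 'rV[R]_n := \row_i ptilde p [set i].

Definition partials U (f : 'rV[R]_n -> R) : 'rV[R]_n -> R :=
  foldr (fun (i : 'I_n) (g : 'rV[R]_n -> R) => 'D_(delta_mx 0 i) g) f (enum U).

Definition rcoef p T : R :=
  - (p [set: 'I_n])^-1 * partials (~: T) (affine p) (thetaP p).

Definition Rpoly p z : R :=
  \sum_(T : {set 'I_n} | (2 <= #|T|)%N) rcoef p T * monom z T.

(* (0, theta_N) for N = [n] \ {i1} *)
Definition zero_at (i1 : 'I_n) theta : 'rV[R]_n :=
  \row_i (if i == i1 then 0 else theta 0 i).

Definition SN p (i1 : 'I_n) theta : R :=
  \sum_(T : {set 'I_n} | T \subset [set~ i1])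
     p (i1 |: T) / p [set i1] * monom theta T.

Definition Svec p theta : 'rV[R]_n :=
  \row_i (1 + (- ptilde p [set i])^-1 * theta 0 i).

End AffinePolynomials.

Local Open Scope classical_set_scope.

Section Distributions.
Context {R : realType} {n : nat}.
Local Open Scope ereal_scope.

Definition laplace (mu : {measure set (n.-tuple R) -> \bar R})
    (theta : 'rV[R]_n) : \bar R :=
  \int[mu]_x (expR (- (\sum_(i < n) theta 0 i * tnth x i)))%:E.

(* Since powR takes junk values at nonpositive bases, the positivity of f,
   implicit in the real power f `^ (- a), is required explicitly. *)
Definition laplace_is_powN (mu : {measure set (n.-tuple R) -> \bar R})
    (f : 'rV[R]_n -> R) (a : R) : Prop :=
  exists A : set 'rV[R]_n, A° !=set0 /\
    forall theta, A theta ->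
      (0 < f theta)%R /\ laplace mu theta = (f theta `^ (- a))%:E.

Definition is_mvgamma (mu : probability (n.-tuple R) R)
    (p : {set 'I_n} -> R) (lambda : R) : Prop :=
  laplace_is_powN mu (affine p) lambda.

Definition mvgamma_infinitely_divisible
    (p : {set 'I_n} -> R) (lambda : R) : Prop :=
  forall t : R, (0 < t)%R ->
    exists mu : {measure set (n.-tuple R) -> \bar R},
      laplace_is_powN mu (affine p) (lambda * t).

End Distributions.

Section Conditioning.
Context {R : realType} {d : measure_display} {Omega : measurableType d}.
Variable Pr : probability Omega R.
Local Open Scope ereal_scope.

(* x |-> g x is a version of x |-> E[Y | Z = x] *)
Definition is_cond_expectation (Y Z : Omega -> R) (g : R -> R) : Prop :=
  [/\ Pr.-integrable [set: Omega] (EFin \o Y),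
      measurable_fun [set: R] g &
      forall B : set R, measurable B ->
        \int[Pr]_(w in Z @^-1` B) (Y w)%:E =
        \int[Pr]_(w in Z @^-1` B) (g (Z w))%:E].

(* L x1 theta is a version of the Laplace transform, at theta_N >= 0, of
   (X_i)_(i in N) given X_i1 = x1, where N = [n] \ {i1}; the i1-th coordinate
   of theta plays no role. *)
Definition is_cond_laplace (n : nat) (X : {RV Pr >-> n.-tuple R})
    (i1 : 'I_n) (L : R -> 'rV[R]_n -> R) : Prop :=
  forall theta : 'rV[R]_n,
    (forall i, i \in [set~ i1]%SET -> (0 <= theta 0 i)%R) ->
    is_cond_expectation
      (fun w => expR (- (\sum_(i in [set~ i1]%SET) theta 0 i * tnth (X w) i)))
      (fun w => tnth (X w) i1)
      (L ^~ theta).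

End Conditioning.

(* Main.v *)
Require Import Defs.
From HB Require Import structures.
From mathcomp Require Import all_boot all_order all_algebra.
From mathcomp Require Import all_classical all_reals all_analysis.
From mathcomp Require Import measurable_realfun ring lra.
Import Order.TTheory GRing.Theory Num.Theory.
Import numFieldNormedType.Exports.
Local Open Scope ring_scope.
Set Implicit Arguments.
Unset Strict Implicit.
Unset Printing Implicit Defensive.

(* Write L for the Laplace transform of X.  Along a coordinate axis P is affine, P = a + b s,
   so L = P^(-lambda) on an interval of that axis determines all exponentially tilted moments
   of X_i through the binomial series of (a + b s)^(-lambda); the moments in turn force L to be
   finite and equal to P^(-lambda) as long as a + b s > 0.  Hence the identity spreads from any
   open set through boxes on which P > 0.  It reaches the origin because
   L(u theta) <= 1 + L(theta) for u in [0, 1] keeps P away from 0 on a segment, and then, one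
   coordinate at a time, the closed orthant: the sign of the slope b is the sign of X_j, hence
   does not depend on the other coordinates, and it is positive because p_[j] > 0.  In
   particular every X_i is nonnegative and S_N > 0.
   On the line theta_1 = k the same identity shows that exp(-<theta_N, X_N>) and the claimed
   conditional transform have the same integrals against exp(-k X_1) for all natural k, which
   determines them as densities with respect to the law of X_1.
   The formula with the r_T is Taylor's formula for P at theta_P in the directions of N; the
   term T = {1} vanishes because p_N + p_[n] ptilde_1 = 0. *)

(** * The binomial series of (1 - x)^(-l) *)

Section BinomialSeries.
Local Open Scope classical_set_scope.
Context {R : realType}.
Implicit Types (l x : R) (n k : nat).

(** The coefficient of x^k in (1 - x)^(-l): the rising factorial l (l + 1) ... (l + k - 1) over
    k!. *)
Definition binc l k : R := \prod_(i < k) ((l + i%:R) / i.+1%:R).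

Lemma binc0 l : binc l 0 = 1. Proof. by rewrite /binc big_ord0. Qed.

Lemma bincS l k : k.+1%:R * binc l k.+1 = (l + k%:R) * binc l k.
Proof.
rewrite /binc big_ord_recr /= mulrC -mulrA mulfVK ?pnatr_eq0//.
by rewrite mulrC.
Qed.

Lemma binc_shift l k : (l + k%:R) * binc l k = l * binc (l + 1) k.
Proof.
elim: k => [|k ih]; first by rewrite !binc0 addr0.
have k0 : k.+1%:R != 0 :> R by rewrite pnatr_eq0.
apply: (mulfI k0); rewrite mulrCA bincS ih mulrCA [RHS]mulrCA bincS.
by rewrite -natr1; ring.
Qed.

Lemma binc_ge0 l k : 0 < l -> 0 <= binc l k.
Proof.
by move=> l0; apply: prodr_ge0 => i _; rewrite divr_ge0// addr_ge0// ltW.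
Qed.

(** The function (1 - x)^(-l) solves (1 - x) y' = l y; its Taylor polynomial solves the same
    equation up to a single term of top degree. *)
Lemma binc_poly_ode l n (q := \sum_(k < n.+1) (binc l k)%:P * 'X^k) :
  (1 - 'X) * q^`() = l%:P * q - (l * binc (l + 1) n)%:P * 'X^n.
Proof.
rewrite {}/q; elim: n => [|n ih].
  rewrite big_ord_recr big_ord0 /= binc0 add0r !binc0 expr0 !mulr1.
  by rewrite derivC mulr0 subrr.
rewrite big_ord_recr /= derivD mulrDr ih derivM derivC mul0r add0r derivXn /=.
rewrite -!binc_shift -natr1.
have := bincS l n; rewrite -natr1 => e.
rewrite -[X in _ * (_ * X)]mulr_natl (mulrA _ (_%:R)) -polyC_natr.
rewrite -polyCM (mulrC (binc l _)) -natr1 e.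
have e2 : (n%:R + 1) * binc l n.+1 = (l + n%:R) * binc l n by [].
have -> : (l + (n%:R + 1)) * binc l n.+1 = l * binc l n.+1 + (l + n%:R) * binc l n.
  by rewrite -e2; ring.
rewrite !(polyCD, polyCM) exprS; ring.
Qed.

Definition bins l n x : R := \sum_(k < n) binc l k * x ^+ k.

(** By the differential equation, everything in the derivative of the product cancels except the
    top-degree term, so the product stays close to its value 1 at 0. *)
Lemma bins_derive l n x : x < 1 ->
  is_derive x 1 (fun y => bins l n.+1 y * (1 - y) `^ l)
    (- (l * binc (l + 1) n * x ^+ n * (1 - x) `^ (l - 1))).
Proof.
move=> x1; have x10 : 0 < 1 - x by rewrite subr_gt0.
pose q := \sum_(k < n.+1) (binc l k)%:P * 'X^k.
have qE y : bins l n.+1 y = q.[y].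
  by rewrite horner_sum; apply: eq_bigr => i _; rewrite !hornerE.
have dp : is_derive x 1 (fun y : R => (1 - y) `^ l)
    (l * (1 - x) `^ (l - 1) * (0 - 1)).
  have h1 : is_derive (1 - x) 1 (fun y => y `^ l) (l * (1 - x) `^ (l - 1)).
    exact: is_derive1_powR.
  have h2 : is_derive x 1 (fun y : R => 1 - y) (0 - 1) by exact: is_deriveB.
  exact: (@is_derive1_comp R (fun y => y `^ l) (fun y => 1 - y)).
have -> : (fun y => bins l n.+1 y * (1 - y) `^ l) =
  (fun y => q.[y]) * (fun y : R => (1 - y) `^ l).
  by apply/funext => y; rewrite qE.
apply: is_derive_eq.
have := congr1 (fun r => r.[x]) (binc_poly_ode l n).
rewrite -/q !hornerE => ode.
have -> : (1 - x) `^ l = (1 - x) * (1 - x) `^ (l - 1).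
  rewrite -{1}(subrKC 1 l) (@powRD _ _ 1); last by rewrite (gt_eqF x10) implybT.
  by rewrite powRr1// ltW.
rewrite /GRing.scale /=.
have -> : (1 - x) * (1 - x) `^ (l - 1) * q^`().[x] =
  ((1 - x) * q^`().[x]) * (1 - x) `^ (l - 1) by ring.
rewrite ode; ring.
Qed.

Lemma bins0 l n : bins l n.+1 0 = 1.
Proof.
rewrite /bins big_ord_recl /= binc0 expr0 mulr1 big1 ?addr0// => i _.
by rewrite expr0n mulr0.
Qed.

Lemma bins_continuous l n (a b : R) : b < 1 ->
  {within `[a, b], continuous (fun y => bins l n.+1 y * (1 - y) `^ l)}.
Proof.
move=> b1; apply: derivable_within_continuous => x; rewrite in_itv /= => /andP[_ xb].
have [] := @bins_derive l n x (le_lt_trans xb b1); by [].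
Qed.

(** The mean value theorem between 0 and [x]. The condition [0 <= c * x] puts [c] on the side of
    [x], which fixes the sign of the remainder in [bins_le]. *)
Lemma bins_mvt l n x : `|x| < 1 -> exists c, [/\ `|c| <= `|x|, 0 <= c * x &
  bins l n.+1 x * (1 - x) `^ l - 1 =
    - (l * binc (l + 1) n * c ^+ n * (1 - c) `^ (l - 1)) * x].
Proof.
move=> x1; have x1' : x < 1 by apply: le_lt_trans x1; exact: ler_norm.
pose df y := - (l * binc (l + 1) n * y ^+ n * (1 - y) `^ (l - 1)).
pose f y := bins l n.+1 y * (1 - y) `^ l.
have f0 : f 0 = 1 by rewrite /f bins0 subr0 powR1 mul1r.
have dfP (y : R) : y < 1 -> is_derive y 1 f (df y) by exact: bins_derive.
have [x0|x0] := leP 0 x.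
  have [y||c] := @MVT_segment R f df 0 x x0.
  - by rewrite in_itv /= => /andP[_ yx]; apply: dfP (lt_trans yx x1').
  - exact: bins_continuous.
  rewrite in_itv /= f0 subr0 => /andP[c0 cx] e; exists c; split => //.
    by rewrite !ger0_norm.
  by rewrite mulr_ge0.
have [y||c] := @MVT_segment R f df x 0 (ltW x0).
- by rewrite in_itv /= => /andP[_ yx]; apply: dfP (lt_trans yx ltr01).
- exact: bins_continuous.
rewrite in_itv /= f0 sub0r => /andP[xc c0] e; exists c; split.
- by rewrite ler0_norm// ltr0_norm// lerN2.
- by rewrite mulr_le0// ltW.
- by rewrite -[LHS]opprB e mulrN opprK.
Qed.

Lemma bins_le l n x : 0 < l -> 0 <= x -> x < 1 ->
  bins l n x <= (1 - x) `^ (- l).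
Proof.
move=> l0 x0 x1; have y0 : 0 < (1 - x) `^ l by rewrite powR_gt0// subr_gt0.
case: n => [|n]; first by rewrite /bins big_ord0 powR_ge0.
rewrite powRN -(ler_pM2r y0) mulVf ?gt_eqF//.
have [|c [_ cx /eqP]] := @bins_mvt l n x; first by rewrite ger0_norm.
have [c0|c0] := leP 0 c.
  rewrite subr_eq => /eqP ->; rewrite gerDr mulNr oppr_le0.
  by rewrite !mulr_ge0 ?powR_ge0 ?exprn_ge0 ?binc_ge0 ?addr_gt0// ltW.
have -> : x = 0.
  by apply/eqP; rewrite eq_le x0 andbT -(ler_nM2l c0) mulr0.
by rewrite mulr0 => /eqP/subr0_eq ->.
Qed.

(** The remainder is at most a constant times [binc (l + 1) n * K ^+ n]. This is the general term of
    a series whose partial sums are bounded by [bins_le] at exponent [l + 1], so it tends to 0. *)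
Lemma bins_cvg l x : 0 < l -> `|x| < 1 ->
  bins l ^~ x @ \oo --> (1 - x) `^ (- l).
Proof.
move=> l0 x1.
have x1' : x < 1 by apply: le_lt_trans x1; exact: ler_norm.
have y0 : 0 < (1 - x) `^ l by rewrite powR_gt0// subr_gt0.
set K := `|x|.
(* The power is monotone in its base, in a direction given by the sign of [l - 1], so an end point
   of |y| <= K gives its maximum. *)
pose M := Num.max ((1 - K) `^ (l - 1)) ((1 + K) `^ (l - 1)).
have K0 : 0 <= K by exact: normr_ge0.
have powM y : `|y| <= K -> (1 - y) `^ (l - 1) <= M.
  move=> yK; have [yl yu] := (ler_normlP _ _ yK).
  rewrite /M le_max; have [l1|l1] := leP 1 l.
    apply/orP; right; apply: ge0_ler_powR; rewrite ?nnegrE; rewrite -/K in x1; lra.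
  apply/orP; left; rewrite -(opprB 1 l) !powRN.
  rewrite lef_pV2 ?posrE ?powR_gt0//; rewrite -/K in x1; try lra.
  by apply: ge0_ler_powR; rewrite ?nnegrE; lra.
have main n : `|bins l n.+1 x * (1 - x) `^ l - 1| <=
    l * (binc (l + 1) n * K ^+ n) * M * K.
  have [c [cK _ ->]] := bins_mvt l n x1.
  rewrite normrM -/K ler_wpM2r// normrN !normrM.
  rewrite (ger0_norm (powR_ge0 _ _)) (gtr0_norm l0).
  rewrite (@ger0_norm _ (binc _ _)) ?binc_ge0 ?addr_gt0// normrX -!mulrA.
  rewrite ler_wpM2l ?(ltW l0)// ler_wpM2l ?binc_ge0 ?addr_gt0//.
  by rewrite ler_pM ?exprn_ge0 ?powR_ge0 ?lerXn2r ?nnegrE ?powM.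
have t0 : ((fun n => binc (l + 1) n * K ^+ n) @ \oo --> (0 : R))%classic.
  apply: (cvg_series_cvg_0 (u_ := fun n => binc (l + 1) n * K ^+ n)).
  apply: nondecreasing_is_cvgn.
    apply: nondecreasing_series => k _ _.
    by rewrite mulr_ge0 ?exprn_ge0 ?binc_ge0 ?addr_gt0.
  exists ((1 - K) `^ (- (l + 1))) => _ [n _ <-].
  by rewrite seriesEord; apply: bins_le; rewrite ?addr_gt0.
rewrite -(cvg_shiftS (bins l ^~ x)).
have -> : (fun n => bins l n.+1 x) =
   (fun n => (1 - x) `^ (- l) * (1 + (bins l n.+1 x * (1 - x) `^ l - 1))).
  apply/funext => n; rewrite subrKC powRN mulrC mulfK// gt_eqF//.
suff h : (bins l n.+1 x * (1 - x) `^ l - 1) @[n --> \oo] --> 0.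
  have := cvgMl_tmp (a := (1 - x) `^ (- l)) (cvgD (cvg_cst (1 : R)) h).
  by rewrite addr0 mulr1; apply.
apply/norm_cvg0P; apply: (@squeeze_cvgr _ _ _ _ (fun=> 0)
  (fun n => l * (binc (l + 1) n * K ^+ n) * M * K)).
- by apply: nearW => n; rewrite normr_ge0 /= main.
- exact: cvg_cst.
- have -> : 0 = l * 0 * M * K :> R by ring.
  by do 2 apply: cvgMr_tmp; apply: cvgMl_tmp.
Qed.

End BinomialSeries.

(** * Uniqueness of power series coefficients *)

Section PowerSeriesUnique.
Context {R : realType}.
Local Open Scope classical_set_scope.

Lemma geo_half_le (x : R) n : 0 <= x -> x <= 2^-1 -> \sum_(j < n) x ^+ j <= 2.
Proof.
move=> x0 x1; suff : \sum_(j < n) x ^+ j <= 2 - 2 * x ^+ n.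
  by move=> h; apply: le_trans h _; rewrite gerBl mulr_ge0 ?exprn_ge0.
elim: n => [|n ih]; first by rewrite big_ord0 expr0; lra.
rewrite big_ord_recr /= exprS; have := exprn_ge0 n x0; nra.
Qed.

(** Strong induction on k. Once the lower coefficients vanish, the series at [x * h0] differs from
    its k-th term by O(x^(k+1)), since the terms at [h0] are bounded and x <= 1/2 gives a geometric
    tail. Dividing by x^k and letting x tend to 0 yields d_k = 0. *)
Lemma pseries_eq0 (d : nat -> R) (r : R) : 0 < r ->
  (forall h, `|h| < r -> series (fun k => d k * h ^+ k) @ \oo --> (0 : R)) ->
  forall k, d k = 0.
Proof.
move=> r0 H; set h0 := r / 2; have h00 : 0 < h0 by rewrite divr_gt0.
have h0r : `|h0| < r by rewrite gtr0_norm// /h0; lra.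
have [B B0 HB] : exists2 B, 0 <= B & forall j, `|d j * h0 ^+ j| <= B.
  have /cvg_series_bounded [M [_ HM]] : cvgn (series (fun k => d k * h0 ^+ k)).
    by apply/cvg_ex; exists 0; exact: H.
  exists (`|M| + 1); first by rewrite addr_ge0.
  by move=> j; apply: (HM (`|M| + 1)) => //; rewrite (le_lt_trans (ler_norm M))// ltrDl.
elim/ltn_ind => k ih.
have key x : 0 < x -> x <= 2^-1 -> `|d k| * h0 ^+ k <= 2 * B * x.
  move=> x0 x1; set h := x * h0.
  have hr : `|h| < r.
    rewrite /h normrM (gtr0_norm x0) (gtr0_norm h00).
    have : x * h0 <= 2^-1 * h0 by rewrite ler_pM2r.
    rewrite /h0; lra.
  have bd n : `|series (fun k => d k * h ^+ k) (n + k.+1)%N - d k * h ^+ k| <=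
      2 * B * x ^+ k.+1.
    rewrite seriesEord /= addnC big_split_ord /= big_ord_recr /= big1 ?add0r; last first.
      by move=> i _; rewrite ih// mul0r.
    rewrite addrAC subrr add0r; apply: le_trans (ler_norm_sum _ _ _) _.
    apply: (@le_trans _ _ (\sum_(i < n) B * x ^+ k.+1 * x ^+ i)).
      apply: ler_sum => i _; rewrite /h exprMn mulrCA normrM -mulrA -exprD mulrC.
      rewrite (ger0_norm (exprn_ge0 _ (ltW x0))).
      by rewrite ler_wpM2r ?exprn_ge0 ?(ltW x0).
    rewrite -mulr_sumr mulrAC (mulrC 2) ler_wpM2r ?exprn_ge0 ?(ltW x0)//.
    by rewrite ler_wpM2l// geo_half_le// ltW.
  have lim : `|series (fun k => d k * h ^+ k) (n + k.+1)%N - d k * h ^+ k|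
      @[n --> \oo] --> `|0 - d k * h ^+ k|.
    apply: cvg_norm; apply: cvgB; last exact: cvg_cst.
    by have := H h hr; rewrite -(cvg_shiftn k.+1).
  have : `|0 - d k * h ^+ k| <= 2 * B * x ^+ k.+1.
    rewrite -(cvg_lim _ lim)//; apply: limr_le.
      by apply/cvg_ex; eexists; exact: lim.
    by apply: nearW => n; exact: bd.
  rewrite sub0r normrN /h exprMn exprS !normrM.
  rewrite (ger0_norm (exprn_ge0 k (ltW x0))) (ger0_norm (exprn_ge0 k (ltW h00))).
  by rewrite (mulrCA `|_|) [X in _ <= X]mulrA (mulrC (x ^+ k)) ler_pM2r ?exprn_gt0.
have : `|d k| * h0 ^+ k <= 0.
  apply/ler_addgt0Pr => e e0; rewrite add0r.
  pose x := Num.min 2^-1 (e / (2 * B + 1)).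
  have x0 : 0 < x by rewrite lt_min invr_gt0 ltr0n /= divr_gt0//; lra.
  apply: le_trans (key x x0 _) _; first by rewrite ge_min lexx.
  have : x <= e / (2 * B + 1) by rewrite ge_min lexx orbT.
  rewrite ler_pdivlMr; last lra.
  by nra.
rewrite pmulr_lle0 ?exprn_gt0// normr_le0 => /eqP //.
Qed.

End PowerSeriesUnique.

(** * Laplace integrals along a line and their tilted moments *)

Section LaplaceLine.
Context {R : realType} {d : measure_display} {T : measurableType d}.
Variables (mu : {measure set T -> \bar R}) (Y Z : T -> R).
Hypotheses (mY : measurable_fun [set: T] Y) (mZ : measurable_fun [set: T] Z).
Local Open Scope classical_set_scope.

(** [Y] is the coordinate that varies along the line; [Z] collects the fixed part of the
    exponent. *)
Definition tilt (s : R) (w : T) : R := expR (Z w - s * Y w).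

Definition lapline (s : R) : \bar R := (\int[mu]_w (tilt s w)%:E)%E.

(** The factor 1/k! makes the integrals the Taylor coefficients of h |-> [lapline (s - h)]. *)
Definition tmom (s : R) (k : nat) (w : T) : R := (Y w ^+ k / k`!%:R * tilt s w).

(** [fine] is 0 at an infinite integral, so the value is meaningful only together with integrability
    of [tmom s k]. *)
Definition moment (s : R) (k : nat) : R := fine (\int[mu]_w (tmom s k w)%:E)%E.

Lemma tilt_gt0 s w : (0 < tilt s w). Proof. exact: expR_gt0. Qed.

Lemma tilt_ge0 s w : (0 <= tilt s w). Proof. exact: expR_ge0. Qed.

Lemma measurable_tilt s : measurable_fun [set: T] (tilt s).
Proof.
apply: measurableT_comp => //; apply: measurable_funB => //.
by apply: measurable_funM => //; exact: measurable_cst.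
Qed.

Lemma measurable_tmom s k : measurable_fun [set: T] (tmom s k).
Proof.
apply: measurable_funM; last exact: measurable_tilt.
by apply: measurable_funM; [exact: measurable_funX|exact: measurable_cst].
Qed.

Lemma lapline_ge0 s : (0 <= lapline s)%E.
Proof. by apply: integral_ge0 => w _; rewrite lee_fin tilt_ge0. Qed.

Lemma integrable_tilt s : (lapline s < +oo)%E -> mu.-integrable [set: T] (EFin \o tilt s).
Proof.
move=> h; apply/integrableP; split; first exact/measurable_EFinP/measurable_tilt.
rewrite (eq_integral (EFin \o tilt s))// => w _ /=.
by rewrite ger0_norm// tilt_ge0.
Qed.

Lemma tilt_shift s h w : tilt (s - h) w = (expR (h * Y w) * tilt s w).
Proof. by rewrite /tilt -expRD; congr expR; ring. Qed.

Lemma psum_exp_le (x : R) n : (`|\sum_(k < n) x ^+ k / k`!%:R| <= expR `|x|).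
Proof.
apply: le_trans (ler_norm_sum _ _ _) _.
have -> : (\sum_(i < n) `|x ^+ i / i`!%:R|) = series (exp_coeff `|x|) n.
  rewrite seriesEord; apply: eq_bigr => i _.
  by rewrite /exp_coeff /= normrM normrX normfV normr_nat.
apply: nondecreasing_cvgn_le; last exact: is_cvg_series_exp_coeff.
by apply: nondecreasing_series => k _ _; exact: exp_coeff_ge0.
Qed.

Lemma expR_norm_le (x : R) : (expR `|x| <= expR x + expR (- x)).
Proof.
have [x0|x0] := leP 0 x.
  by rewrite ger0_norm// lerDl expR_ge0.
by rewrite ltr0_norm// lerDr expR_ge0.
Qed.

Section Series.
Variables (s r : R).
Hypothesis r0 : (0 < r).
Hypotheses (lapl : (lapline (s - r) < +oo)%E) (lapr : (lapline (s + r) < +oo)%E).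

(** An integrable majorant, uniform in |h| <= r, of all partial sums of the exponential series of
    [h * Y] times the weight at [s]. *)
Let dom (w : T) : R := (tilt (s - r) w + tilt (s + r) w).

Let idom : mu.-integrable [set: T] (EFin \o dom).
Proof.
rewrite (_ : EFin \o dom = ((EFin \o tilt (s - r)) \+ (EFin \o tilt (s + r)))%E) //.
by apply: integrableD => //; exact: integrable_tilt.
Qed.

Let domE h w : (`|h| <= r) -> (expR `|h * Y w| * tilt s w <= dom w).
Proof.
move=> hr; rewrite /dom -{2}(opprK r) !tilt_shift -mulrDl ler_wpM2r ?tilt_ge0//.
apply: (@le_trans _ _ (expR `|r * Y w|)); last by rewrite mulNr expR_norm_le.
by rewrite ler_expR !normrM (gtr0_norm r0) ler_wpM2r.
Qed.

(** One term of the exponential series of |r Y| is at most e^|r Y|, so [r ^- k * dom] dominates. *)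
Lemma integrable_tmom k : mu.-integrable [set: T] (EFin \o tmom s k).
Proof.
have : mu.-integrable [set: T] (fun w => (r ^- k)%:E * (EFin \o dom) w)%E.
  exact: integrableZl.
apply: le_integrable => //; first exact/measurable_EFinP/measurable_tmom.
move=> w _ /=; rewrite lee_fin.
have rk : (0 < r ^+ k) by rewrite exprn_gt0.
rewrite [leRHS]ger0_norm; last first.
  by rewrite mulr_ge0 ?invr_ge0 ?ltW// /dom addr_gt0 ?tilt_gt0.
rewrite mulrC ler_pdivlMr//; apply: le_trans (domE w (h := r) _); last first.
  by rewrite gtr0_norm.
rewrite /tmom 2!normrM (ger0_norm (tilt_ge0 s w)) mulrAC.
rewrite ler_wpM2r ?tilt_ge0//.
have := psum_exp_le (`|r * Y w|) k.+1; rewrite normr_id; apply: le_trans.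
rewrite [leRHS]ger0_norm; last by apply: sumr_ge0 => i _; rewrite divr_ge0 ?exprn_ge0.
rewrite big_ord_recr /= normfV normr_nat normrM (gtr0_norm r0) exprMn normrX.
rewrite mulrAC (mulrC (`|_| ^+ _)) lerDr sumr_ge0// => i _.
by rewrite divr_ge0// exprn_ge0// mulr_ge0// ltW.
Qed.

(** Dominated convergence for the partial sums of e^(h Y) against the weight at [s]. *)
Lemma moment_series h : (`|h| <= r) ->
  (lapline (s - h) < +oo)%E /\
  ((fun n => \sum_(k < n) moment s k * h ^+ k) @ \oo --> fine (lapline (s - h))).
Proof.
move=> hr.
pose f n w : \bar R := (\sum_(k < n) (h ^+ k)%:E * (tmom s k w)%:E)%E.
have fE n w : f n w = ((\sum_(k < n) (h * Y w) ^+ k / k`!%:R) * tilt s w)%:E.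
  rewrite /f mulr_suml -sumEFin; apply: eq_bigr => k _; rewrite -EFinM.
  by rewrite /tmom exprMn !mulrA.
have mf n : measurable_fun [set: T] (f n).
  apply: emeasurable_sum => k; apply: emeasurable_funM; first exact: measurable_cst.
  exact/measurable_EFinP/measurable_tmom.
have ff w : [set: T] w -> f ^~ w @ \oo --> (tilt (s - h) w)%:E.
  move=> _; under eq_fun do rewrite fE.
  apply/cvg_EFin; first by apply: nearW.
  rewrite tilt_shift; apply: cvgMr_tmp.
  have := is_cvg_series_exp_coeff (h * Y w).
  by rewrite /expR seriesEord.
have fd n w : [set: T] w -> (`|f n w| <= (EFin \o dom) w)%E.
  move=> _; rewrite fE /= lee_fin normrM (ger0_norm (tilt_ge0 s w)).
  by apply: le_trans (domE w hr); rewrite ler_wpM2r ?tilt_ge0// psum_exp_le.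
have mt : measurable_fun [set: T] (EFin \o tilt (s - h)).
  exact/measurable_EFinP/measurable_tilt.
have [/integrable_lty lt _ cv] := dominated_convergence measurableT mf mt
  (aeW mu ff) idom (aeW mu (fun w n Tw => fd n w Tw)).
split; first exact: lt.
have fn : lapline (s - h) = (fine (lapline (s - h)))%:E.
  by rewrite fineK// ge0_fin_numE ?lapline_ge0//; exact: lt.
apply: (@fine_cvg _ _ _ _ (fun n => (\sum_(k < n) moment s k * h ^+ k)%:E)).
rewrite -fn.
suff -> : (fun n => (\sum_(k < n) moment s k * h ^+ k)%:E) =
  (fun n => \int[mu]_w f n w)%E by exact: cv.
apply/funext => n.
rewrite integral_sum//=; last by move=> k; apply: integrableZl => //; exact: integrable_tmom.
rewrite -sumEFin; apply: eq_bigr => k _; rewrite integralZl//; last exact: integrable_tmom.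
rewrite EFinM muleC /moment fineK//; apply: integrable_fin_num => //.
exact: integrable_tmom.
Qed.

End Series.

(** Finiteness is deduced from the moments alone. In h^k + (-h)^k the odd terms cancel, so the
    series for the sum of the weights at [s - h] and [s + h] has nonnegative terms, and monotone
    convergence bounds its integral by [2 * B]. *)
Lemma lapline_finite s h (B : R) :
  (forall k, mu.-integrable [set: T] (EFin \o tmom s k)) ->
  (forall n, \sum_(k < n) `|moment s k * h ^+ k| <= B) ->
  (lapline (s - h) < +oo)%E /\ (lapline (s + h) < +oo)%E.
Proof.
move=> itm bd.
pose c k : R := (h ^+ k + (- h) ^+ k).
have cY k w : (0 <= c k * tmom s k w).
  have -> : (c k * tmom s k w = ((h * Y w) ^+ k + (- (h * Y w)) ^+ k) / k`!%:R * tilt s w).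
    by rewrite /c /tmom -mulNr !exprMn; ring.
  rewrite mulr_ge0 ?tilt_ge0// divr_ge0// exprNn -signr_odd.
  case: (boolP (odd k)) => ok /=; first by rewrite expr1 mulN1r subrr.
  by rewrite expr0 mul1r addr_ge0// exprn_even_ge0.
pose f n w : \bar R := (\sum_(k < n) (c k)%:E * (tmom s k w)%:E)%E.
have mt k : measurable_fun [set: T] (fun w => (c k)%:E * (tmom s k w)%:E)%E.
  apply: emeasurable_funM; first exact: measurable_cst.
  exact/measurable_EFinP/measurable_tmom.
have mf n : measurable_fun [set: T] (f n) by apply: emeasurable_sum => k.
have f0 n w : [set: T] w -> (0 <= f n w)%E.
  by move=> _; apply: sume_ge0 => k _; rewrite -EFinM lee_fin.
have nd w : [set: T] w -> nondecreasing_seq (f ^~ w).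
  move=> _; apply/nondecreasing_seqP => n; rewrite /f big_ord_recr /= leeDl//.
  by rewrite -EFinM lee_fin.
have cv := @cvg_monotone_convergence _ _ _ mu _ measurableT f mf f0 nd.
have fl w : limn (f ^~ w) = (tilt (s - h) w + tilt (s + h) w)%:E.
  apply/cvg_lim => //.
  have -> : f ^~ w = (fun n => (((series (exp_coeff (h * Y w)) n
      + series (exp_coeff (- h * Y w)) n) * tilt s w)%:E)).
    apply/funext => n; rewrite /f !seriesEord /= -big_split /= mulr_suml -sumEFin.
    apply: eq_bigr => k _; rewrite -EFinM /c /tmom /exp_coeff /= !exprMn.
    by congr EFin; ring.
  apply/cvg_EFin; first by apply: nearW.
  have -> : tilt (s - h) w + tilt (s + h) w =
      (expR (h * Y w) + expR (- h * Y w)) * tilt s w.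
    by rewrite mulrDl -!tilt_shift opprK.
  apply: cvgMr_tmp.
  by apply: cvgD; exact: is_cvg_series_exp_coeff.
have le : (\int[mu]_w (tilt (s - h) w + tilt (s + h) w)%R%:E <= (2 * B)%:E)%E.
  under eq_integral do rewrite -fl.
  rewrite -(cvg_lim _ cv)//; apply: lime_le.
    by apply/cvg_ex; eexists; exact: cv.
  apply: nearW => n; rewrite integral_sum//=; last first.
    by move=> k; apply: integrableZl => //; exact: itm.
  apply: (@le_trans _ _ (\sum_(k < n) (2 * `|moment s k * h ^+ k|)%:E)%E); last first.
    by rewrite sumEFin -mulr_sumr lee_fin ler_wpM2l.
  apply: lee_sum => k _; rewrite integralZl//; last exact: itm.
  rewrite -[X in (_ * X)%E]fineK; last exact: (integrable_fin_num measurableT (itm k)).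
  rewrite -EFinM lee_fin -/(moment s k); apply: le_trans (ler_norm _) _.
  rewrite !normrM mulrCA mulrC ler_wpM2l// /c.
  by rewrite (le_trans (ler_normD _ _))// !normrX normrN mulr_natl mulr2n.
have lt t : (t = s - h \/ t = s + h) -> (lapline t < +oo)%E.
  move=> ht; apply: (le_lt_trans _ (ltry (2 * B))); apply: (le_trans _ le).
  apply: ge0_le_integral => //.
  - by move=> w _; rewrite lee_fin tilt_ge0.
  - exact/measurable_EFinP/measurable_tilt.
  - by apply/measurable_EFinP; apply: measurable_funD; exact: measurable_tilt.
  - by move=> w _; rewrite lee_fin; case: ht => ->; rewrite ?lerDl ?lerDr tilt_ge0.
by split; apply: lt; [left|right].
Qed.

End LaplaceLine.

(** * Spreading the identity along one line *)

Section Extension.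
Context {R : realType} {d : measure_display} {T : measurableType d}.
Variables (mu : {measure set T -> \bar R}) (Y Z : T -> R).
Hypotheses (mY : measurable_fun [set: T] Y) (mZ : measurable_fun [set: T] Z).
Variables (a b l : R).
Hypothesis l0 : 0 < l.
Local Open Scope classical_set_scope.

Let lap := lapline mu Y Z.

Definition gamma_at (s : R) : Prop :=
  0 < a + b * s /\ lap s = ((a + b * s) `^ (- l))%:E.

Definition gamma_near (s0 : R) : Prop :=
  exists2 r : R, 0 < r & forall s, `|s - s0| <= r -> gamma_at s.

(** The condition on [s] is the disc of convergence of the binomial series around [s0]. Near [s0]
    the two power series agree, which identifies the moments; absolute convergence of the binomial
    series then makes the transform finite at [s], where summing the moments gives its value. *)
Lemma gamma_near_disc s0 s : gamma_near s0 -> `|b * (s - s0)| < a + b * s0 ->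
  gamma_at s.
Proof.
move=> [r r0 H]; set u := a + b * s0; set h := s0 - s.
(* An opaque name for the ratio b / u, so that a + b (s0 - h') = u (1 - k h'). *)
have [k kD] : exists k, k = b / u by exists (b / u).
have [u0 _] : gamma_at s0 by apply: H; rewrite subrr normr0 ltW.
rewrite -/u in u0.
have uh h' : u - b * h' = u * (1 - k * h').
  by rewrite kD; field; rewrite gt_eqF.
have sub h' : a + b * (s0 - h') = u - b * h' by rewrite /u; ring.
set F := u `^ (- l).
have powF h' : `|k * h'| < 1 ->
    0 < a + b * (s0 - h') /\ (a + b * (s0 - h')) `^ (- l) = F * (1 - k * h') `^ (- l).
  move=> kh; have kh1 : k * h' < 1 by apply: le_lt_trans kh; exact: ler_norm.
  rewrite sub uh pmulr_rgt0// subr_gt0; split => //.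
  by rewrite powRM ?subr_ge0 ?ltW.
have kE h' : `|b * h'| < u -> `|k * h'| < 1.
  by move=> bu; rewrite kD mulrAC normrM normfV (gtr0_norm u0) ltr_pdivrMr ?mul1r.
(* Positivity at both s0 - h' and s0 + h' forces |b h'| < u. *)
have kr h' : `|h'| <= r -> `|k * h'| < 1.
  move=> hr.
  have [p1 _] : gamma_at (s0 - h') by apply: H; rewrite addrAC subrr add0r normrN.
  have [p2 _] : gamma_at (s0 + h') by apply: H; rewrite addrAC subrr add0r.
  by apply: kE; rewrite ltr_norml; move: p1 p2; rewrite /u; lra.
have fin1 h' : `|h'| <= r -> (lap (s0 - h') < +oo)%E.
  move=> hr; have [|_ ->] := H (s0 - h'); last exact: ltry.
  by rewrite addrAC subrr add0r normrN.
have finl : (lap (s0 - r) < +oo)%E by apply: fin1; rewrite gtr0_norm.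
have finr : (lap (s0 + r) < +oo)%E.
  by rewrite -(opprK r); apply: fin1; rewrite normrN gtr0_norm.
have itm := integrable_tmom mY mZ r0 finl finr.
have bser h' : `|k * h'| < 1 ->
    (fun n => \sum_(j < n) (F * binc l j * k ^+ j) * h' ^+ j) @ \oo -->
      (a + b * (s0 - h')) `^ (- l).
  move=> kh; have [_ ->] := powF h' kh.
  have -> : (fun n => \sum_(j < n) F * binc l j * k ^+ j * h' ^+ j) =
      (fun n => F * bins l n (k * h')).
    apply/funext => n; rewrite /bins mulr_sumr; apply: eq_bigr => j _.
    by rewrite exprMn !mulrA.
  by apply: cvgMl_tmp; exact: bins_cvg.
have mE j : moment mu Y Z s0 j = F * binc l j * k ^+ j.
  apply/eqP; rewrite -subr_eq0; apply/eqP; move: j.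
  apply: (@pseries_eq0 _ _ r) => // h' /ltW hr.
  have [_ c1] := moment_series mY mZ r0 finl finr hr.
  have c2 := bser h' (kr h' hr).
  have [|_ e] := H (s0 - h'); first by rewrite addrAC subrr add0r normrN.
  rewrite -/lap e /= in c1.
  have c3 := cvgB c1 c2; rewrite subrr in c3; rewrite seriesEord.
  suff -> : (fun n => \sum_(j < n) (moment mu Y Z s0 j - F * binc l j * k ^+ j)
      * h' ^+ j) = (fun n => \sum_(j < n) moment mu Y Z s0 j * h' ^+ j)
    - (fun n => \sum_(j < n) (F * binc l j * k ^+ j) * h' ^+ j) by exact: c3.
  apply/funext => n; rewrite fctE /= -sumrB.
  by apply: eq_bigr => j _; rewrite mulrBl.
move=> bs; have kh : `|k * h| < 1.
  by apply: kE; rewrite /h -(opprB s) mulrN normrN.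
have sE : s = s0 - h by rewrite /h subKr.
have [P1 P2] := powF h kh; rewrite /gamma_at sE; split => //.
(* [moment_series] requires a positive radius, here |h|. *)
have [/eqP h0|h0] := boolP (h == 0).
  have [|_ //] := H (s0 - h); by rewrite h0 subr0 subrr normr0 ltW.
have nh : 0 < `|h| by rewrite normr_gt0.
have bd n : \sum_(j < n) `|moment mu Y Z s0 j * `|h| ^+ j| <= F * (1 - `|k * h|) `^ (- l).
  have -> : \sum_(j < n) `|moment mu Y Z s0 j * `|h| ^+ j| = F * bins l n `|k * h|.
    rewrite /bins mulr_sumr; apply: eq_bigr => j _.
    rewrite mE !normrM (ger0_norm (powR_ge0 _ _)) (ger0_norm (binc_ge0 j l0)).
    by rewrite exprMn !mulrA normrX !normrX normr_id.
  by rewrite ler_wpM2l ?powR_ge0// bins_le.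
have [f1 f2] := lapline_finite mY mZ itm bd.
have [lt c1] := moment_series mY mZ nh f1 f2 (lexx `|h|).
have c2 := bser h kh.
have e : fine (lapline mu Y Z (s0 - h)) = (a + b * (s0 - h)) `^ (- l).
  rewrite -(cvg_lim _ c2)// -(cvg_lim _ c1)//; congr (limn _).
  by apply/funext => n; apply: eq_bigr => j _; rewrite mE.
by rewrite -e fineK// ge0_fin_numE// lapline_ge0.
Qed.

(** The slack [e] in the strict inequality leaves room for an interval around [s] inside the same
    disc. The summand 1 in the radius covers b = 0. *)
Lemma gamma_near_step s0 s : gamma_near s0 -> `|b * (s - s0)| < a + b * s0 ->
  gamma_near s.
Proof.
move=> g0 bs; set e := a + b * s0 - `|b * (s - s0)|.
have e0 : 0 < e by rewrite subr_gt0.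
have b1 : 0 < `|b| + 1 by rewrite ltr_wpDl.
exists (e / (2 * (`|b| + 1))); first by rewrite divr_gt0// mulr_gt0.
move=> s' hs; apply: (gamma_near_disc g0).
rewrite (_ : b * (s' - s0) = b * (s' - s) + b * (s - s0)); last by ring.
apply: le_lt_trans (ler_normD _ _) _; rewrite -ltrBrDr -/e normrM.
move: hs; rewrite ler_pdivlMr ?mulr_gt0// => hs.
have := normr_ge0 (s' - s); have := normr_ge0 b; nra.
Qed.

(** The disc at the midpoint [s0] covers all values a + b s below [u0]. Larger values are reached by
    steps of [u0 / 4], each of which stays within the disc around the preceding point, so k steps
    reach every value below u0 + k u0 / 4. *)
Lemma gamma_extend c e : c < e -> (forall s, c < s < e -> gamma_at s) ->
  forall s, 0 < a + b * s -> gamma_near s.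
Proof.
move=> ce H s us; set s0 := (c + e) / 2.
have g0 : gamma_near s0.
  exists ((e - c) / 4); first by rewrite divr_gt0// subr_gt0.
  by move=> s' /ler_normlP[h1 h2]; apply: H; rewrite /s0 in h1 h2; lra.
set u0 := a + b * s0.
have u00 : 0 < u0 by case: g0 => r r0 /(_ s0)[|//]; rewrite subrr normr0 ltW.
have [b0|b0] := eqVneq b 0; first by apply: (gamma_near_step g0);
  move: u00; rewrite /u0 b0 !mul0r normr0.
suff main (k : nat) s' : 0 < a + b * s' -> a + b * s' < u0 + k%:R * (u0 / 4) ->
    gamma_near s'.
  apply: (main (Num.bound ((a + b * s) / (u0 / 4)))) => //.
  apply: lt_trans (ltr_pwDl u00 (lexx _)).
  rewrite -ltr_pdivrMr ?divr_gt0//.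
  by apply: archi_boundP; rewrite divr_ge0 ?divr_ge0// ltW.
elim: k s' => [|k ih] s' p1 p2.
  apply: (gamma_near_step g0); rewrite ltr_norml.
  move: p1 p2; rewrite mul0r addr0 -/u0 /u0; lra.
have [p3|p3] := ltP (a + b * s') (u0 + k%:R * (u0 / 4)); first exact: ih.
have k0 : 0 <= k%:R * (u0 / 4) by rewrite mulr_ge0// divr_ge0// ltW.
pose s1 := s' - u0 / 4 / b.
have e1 : a + b * s1 = a + b * s' - u0 / 4 by rewrite /s1; field.
have e2 : b * (s' - s1) = u0 / 4 by rewrite /s1; field.
have g1 : gamma_near s1.
  apply: ih; rewrite e1; first by lra.
  by move: p2; rewrite -natr1; lra.
apply: (gamma_near_step g1); rewrite e1 e2 gtr0_norm ?divr_gt0//; lra.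
Qed.

End Extension.

(** * Affine polynomials as functions of one coordinate *)

Section AffineCoordinate.
Context {R : realType} {n : nat}.
Implicit Types (p : {set 'I_n} -> R) (T U : {set 'I_n}) (theta z : 'rV[R]_n).
Implicit Types (j : 'I_n) (s : R).

Definition upd theta j s : 'rV[R]_n := \row_i (if i == j then s else theta 0 i).

(** The partial derivative in direction [j]. Like the value at theta_j = 0 defined next, it does not
    depend on theta_j. *)
Definition slope p theta j : R :=
  \sum_(T : {set 'I_n} | j \notin T) p (j |: T) * monom theta T.

Definition intercept p theta j : R :=
  \sum_(T : {set 'I_n} | j \notin T) p T * monom theta T.

Lemma updE theta j s i : upd theta j s 0 i = if i == j then s else theta 0 i.
Proof. by rewrite mxE. Qed.

Lemma upd_id theta j : upd theta j (theta 0 j) = theta.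
Proof. by apply/rowP => i; rewrite updE; case: eqP => // ->. Qed.

Lemma monom_eq theta z T : (forall i, i \in T -> theta 0 i = z 0 i) ->
  monom theta T = monom z T.
Proof. by move=> h; apply: eq_bigr => i iT; rewrite h. Qed.

Lemma monomU1 theta j T : j \notin T ->
  monom theta (j |: T) = theta 0 j * monom theta T.
Proof. by move=> jT; rewrite /monom big_setU1. Qed.

Lemma monom_upd theta j s T : j \notin T -> monom (upd theta j s) T = monom theta T.
Proof.
move=> jT; apply: monom_eq => i iT; rewrite updE; case: eqP => // ij.
by rewrite -ij iT in jT.
Qed.

Lemma big_set_split j (F : {set 'I_n} -> R) :
  \sum_T F T = \sum_(T : {set 'I_n} | j \notin T) (F T + F (j |: T)).
Proof.
rewrite (bigID (fun T : {set 'I_n} => j \notin T)) /= big_split /=; congr (_ + _).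
rewrite (reindex_onto (fun T => j |: T) (fun T => T :\ j)) /=; last first.
  by move=> T; rewrite negbK => jT; rewrite finset.setD1K.
apply: eq_bigl => T; rewrite !inE eqxx /=.
apply/eqP/idP => [<-|jT]; first by rewrite !inE eqxx.
by rewrite finset.setU1K.
Qed.

Lemma affine_split p theta j :
  affine p theta = intercept p theta j + slope p theta j * theta 0 j.
Proof.
rewrite /affine (big_set_split j) big_split /= /intercept /slope mulr_suml.
by congr (_ + _); apply: eq_bigr => T jT; rewrite monomU1//; ring.
Qed.

Lemma slope_upd p theta j s : slope p (upd theta j s) j = slope p theta j.
Proof. by apply: eq_bigr => T jT; rewrite monom_upd. Qed.

Lemma intercept_upd p theta j s : intercept p (upd theta j s) j = intercept p theta j.
Proof. by apply: eq_bigr => T jT; rewrite monom_upd. Qed.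

Lemma affine_upd p theta j s :
  affine p (upd theta j s) = intercept p theta j + slope p theta j * s.
Proof. by rewrite (affine_split p _ j) intercept_upd slope_upd updE eqxx. Qed.

Lemma monom0 T : monom (0 : 'rV[R]_n) T = (T == finset.set0)%:R.
Proof.
have [->|[i iT]] := set_0Vmem T; first by rewrite /monom big_set0 eqxx.
rewrite /monom (bigD1 i)//= mxE mul0r; case: eqP => // T0.
by rewrite T0 inE in iT.
Qed.

Lemma affine0 p : affine p 0 = p finset.set0.
Proof.
rewrite /affine (bigD1 finset.set0)//= monom0 eqxx mulr1 big1 ?addr0// => T T0.
by rewrite monom0 (negbTE T0) mulr0.
Qed.

Lemma slope0 p j : slope p 0 j = p [set j]%SET.
Proof.
rewrite /slope (bigD1 finset.set0) ?inE//= monom0 eqxx mulr1 finset.setU0.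
rewrite big1 ?addr0// => T /andP[_ T0].
by rewrite monom0 (negbTE T0) mulr0.
Qed.

Lemma affine_continuous p : continuous (affine p : 'rV[R]_n -> R).
Proof.
apply: continuous_big => [|T _]; first exact: add_continuous.
have mc : continuous (fun x : 'rV[R]_n => \prod_(t in T) x 0 t).
  apply: continuous_big => [|i _]; first exact: mul_continuous.
  exact: coord_continuous.
by move=> theta; apply: cvgMl_tmp; [exact: nbhs_filter|exact: mc].
Qed.

(* Evaluated at the point with coordinates t on J and 0 elsewhere, the slope is a
   polynomial in t with leading coefficient p (j |: J). *)
Lemma slope_gt0_large p j (J : {set 'I_n}) : j \notin J -> 0 < p (j |: J) ->
  exists2 t, 0 <= t & 0 < slope p (\row_i (if i \in J then t else 0)) j.
Proof.
move=> jJ pJ; set c := p (j |: J).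
set B := \sum_(T : {set 'I_n}) `|p (j |: T)|.
have B0 : 0 <= B by apply: sumr_ge0.
set t := 1 + B / c; have t1 : 1 <= t by rewrite lerDl divr_ge0// ltW.
have t0 : 0 <= t by apply: le_trans t1.
exists t => //; set theta := \row_i _.
have mJ T : T \subset J -> monom theta T = t ^+ #|T|.
  move=> TJ; rewrite /monom (eq_bigr (fun=> t)) ?prodr_const// => i iT.
  by rewrite mxE (fintype.subsetP TJ).
have mN T : ~~ (T \subset J) -> monom theta T = 0.
  move=> /fintype.subsetPn[i iT iJ].
  by rewrite /monom (bigD1 i)//= mxE (negbTE iJ) mul0r.
(* Multiplying by [t] lets the lower terms be compared with [B * t ^+ #|J|] without an exponent #|J|
   - 1; the choice of [t] makes t c = c + B. *)
rewrite -(pmulr_rgt0 _ (lt_le_trans ltr01 t1)) /slope (bigD1 J)//= mJ// mulrDr.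
set S := \sum_(_ | _) _.
have : `|t * S| <= B * t ^+ #|J|.
  rewrite /S mulr_sumr; apply: le_trans (ler_norm_sum _ _ _) _.
  rewrite mulr_suml big_mkcond /=; apply: ler_sum => T _.
  case: ifPn => [/andP[jT TJ]|_]; last by rewrite mulr_ge0 ?exprn_ge0.
  rewrite mulrCA normrM ler_wpM2l//.
  have [sTJ|sTJ] := boolP (T \subset J); last first.
    by rewrite mN// mulr0 normr0 exprn_ge0.
  rewrite mJ// -exprS ger0_norm ?exprn_ge0// ler_weXn2l// proper_card//.
  by rewrite finset.properEneq TJ.
rewrite ler_norml => /andP[h _].
have tJ : 0 < t ^+ #|J| by rewrite exprn_gt0// (lt_le_trans ltr01).
have : t * (c * t ^+ #|J|) = (c + B) * t ^+ #|J|.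
  by rewrite mulrA /t mulrDl mul1r mulfVK// gt_eqF.
move=> ->; have : 0 < c * t ^+ #|J| by rewrite mulr_gt0.
lra.
Qed.

End AffineCoordinate.

(** * Continuation from an open set to the origin *)

Section Continuation.
Context {R : realType} {d : measure_display} {T : measurableType d} {n : nat}.
Variables (mu : probability T R) (x : 'I_n -> T -> R).
Hypothesis mx : forall i, measurable_fun [set: T] (x i).
Variables (p : {set 'I_n} -> R) (l : R).
Hypothesis l0 : 0 < l.
Local Open Scope classical_set_scope.
Implicit Types (theta eta : 'rV[R]_n) (j : 'I_n).

Definition lap theta : \bar R :=
  (\int[mu]_w (expR (- (\sum_i theta 0 i * x i w)))%:E)%E.

Definition gamma_pt theta : Prop :=
  0 < affine p theta /\ lap theta = ((affine p theta) `^ (- l))%:E.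

Definition others theta j (w : T) : R := - \sum_(i | i != j) theta 0 i * x i w.

Lemma measurable_others theta j : measurable_fun [set: T] (others theta j).
Proof.
apply: measurable_funN; rewrite (_ : (fun w => _) =
  (fun w => \sum_(i < n) (if i != j then theta 0 i * x i w else 0))).
  apply: measurable_sum => i; case: (i != j); last exact: measurable_cst.
  by apply: measurable_funM => //; exact: measurable_cst.
by apply/funext => w; rewrite big_mkcond.
Qed.

Lemma lap_upd theta j s : lap (upd theta j s) = lapline mu (x j) (others theta j) s.
Proof.
apply: eq_integral => w _; rewrite /tilt /others; congr (expR _)%:E.
rewrite (bigD1 j)//= updE eqxx (addrC (s * _)) opprD; congr (_ - _); congr (- _).
by apply: eq_bigr => i ij; rewrite updE (negbTE ij).
Qed.

Lemma gamma_pt_upd theta j s : gamma_pt (upd theta j s) <->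
  gamma_at mu (x j) (others theta j) (intercept p theta j) (slope p theta j) l s.
Proof. by rewrite /gamma_pt /gamma_at affine_upd lap_upd. Qed.

Lemma line_extend theta j (c e : R) : c < e ->
  (forall s, c < s < e -> gamma_pt (upd theta j s)) ->
  forall s, 0 < affine p (upd theta j s) -> gamma_pt (upd theta j s).
Proof.
move=> ce H s; rewrite affine_upd => pos; apply/gamma_pt_upd.
have G s' : c < s' < e -> gamma_at mu (x j) (others theta j)
    (intercept p theta j) (slope p theta j) l s'.
  by move=> hs; apply/gamma_pt_upd/H.
have [r r0 h] := gamma_extend (mx j) (measurable_others theta j) l0 ce G pos.
by apply: h; rewrite subrr normr0 ltW.
Qed.

Definition box theta (r : R) eta : Prop := forall i, `|eta 0 i - theta 0 i| < r.

Lemma nbhs_box theta (A : set 'rV[R]_n) :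
  nbhs theta A <-> exists2 r, 0 < r & forall eta, box theta r eta -> A eta.
Proof.
split=> [/nbhs_ballP[r /= r0 h]|[r r0 h]].
  exists r => // eta b; apply: h; split => // i j.
  by rewrite ord1 /ball /= distrC; exact: b.
apply/nbhs_ballP; exists r => //= eta b; apply: h => i.
by have [_ /(_ 0 i)] := b; rewrite /ball /= distrC.
Qed.

Definition gamma_nbhs theta : Prop := nbhs theta gamma_pt.

(** Coordinates are freed one at a time. At stage [k] the first k coordinates are arbitrary in the
    box and the others stay within [e] of [theta]; positivity of P on the box allows [line_extend]
    to free the next one. *)
Lemma box_extend theta0 (r : R) theta :
  (forall eta, box theta0 r eta -> 0 < affine p eta) ->
  box theta0 r theta -> gamma_nbhs theta ->
  forall eta, box theta0 r eta -> gamma_pt eta.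
Proof.
move=> pos bth /nbhs_box[e e0 He].
suff main (k : nat) eta : box theta0 r eta ->
    (forall i : 'I_n, (k <= i)%N -> `|eta 0 i - theta 0 i| < e) -> gamma_pt eta.
  by move=> eta be; apply: (main n) => // i; rewrite leqNgt ltn_ord.
elim: k eta => [|k ih] eta be he; first by apply: He => i; exact: he.
have [kn|nk] := ltnP k n; last first.
  apply: ih => // i ki; suff : False by [].
  by have := leq_ltn_trans nk (leq_ltn_trans ki (ltn_ord i)); rewrite ltnn.
pose j := Ordinal kn; rewrite -(upd_id eta j).
have bj := bth j.
(* For coordinate [j], the interval common to the box and to the small cube around [theta]. *)
pose c := Num.max (theta 0 j - e) (theta0 0 j - r).
pose c' := Num.min (theta 0 j + e) (theta0 0 j + r).
move: bj; rewrite ltr_distl => /andP[b1 b2].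
apply: (@line_extend _ _ c c'); last by rewrite upd_id; exact: pos.
  rewrite /c /c' gt_max !lt_min; lra.
move=> s; rewrite /c /c' gt_max lt_min => /andP[/andP[s1 s2] /andP[s3 s4]].
apply: ih => i.
  rewrite updE; case: eqP => [->|_]; last exact: be.
  by rewrite ltr_distl s2 s4.
move=> ki; rewrite updE; case: eqP => [->|ij]; first by rewrite ltr_distl s1 s3.
by apply: he; rewrite ltn_neqAle ki andbT; apply/eqP => e1; apply: ij; apply/val_inj.
Qed.

(** Pointwise: e^(-u y) is at most 1 when y >= 0 and at most e^(-y) when y < 0. The total mass 1
    turns this into the bound. *)
Lemma lap_scale_le (u : R) theta : 0 <= u <= 1 -> (lap (u *: theta) <= 1 + lap theta)%E.
Proof.
move=> /andP[u0 u1].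
have mexpR eta : measurable_fun [set: T] (fun w => expR (- (\sum_i eta 0 i * x i w))).
  apply: measurableT_comp => //; apply: measurable_funN.
  apply: measurable_sum => i.
  by apply: measurable_funM => //; exact: measurable_cst.
have mexp eta : measurable_fun [set: T] (fun w => (expR (- (\sum_i eta 0 i * x i w)))%:E).
  exact/measurable_EFinP.
have -> : (1 + lap theta = \int[mu]_w (1 + expR (- (\sum_i theta 0 i * x i w)))%:E)%E.
  under [RHS]eq_integral do rewrite EFinD.
  rewrite ge0_integralD//.
    rewrite integral_cst //; have -> : (1 * mu [set: T])%E = 1%E by rewrite probability_setT mule1.
    by [].
apply: ge0_le_integral => //.
  by apply/measurable_EFinP/measurable_funD; [exact: measurable_cst|exact: mexpR].
move=> w _; rewrite lee_fin.
have -> : \sum_i (u *: theta) 0 i * x i w = u * (\sum_i theta 0 i * x i w).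
  by rewrite mulr_sumr; apply: eq_bigr => i _; rewrite mxE mulrA.
set y := \sum_i _; have [y0|y0] := leP 0 y.
  apply: (@le_trans _ _ 1); last by rewrite lerDl expR_ge0.
  by rewrite -expR0 ler_expR oppr_le0 mulr_ge0.
apply: (@le_trans _ _ (expR (- y))); last by rewrite lerDr.
by rewrite ler_expR lerN2; nra.
Qed.

Lemma gamma_nbhs_pt theta : gamma_nbhs theta -> gamma_pt theta.
Proof. exact: nbhs_singleton. Qed.

(** [E] collects the [u] such that the identity holds near the whole segment from [u *: theta] to
    [theta]. P is at least [m] along it, hence positive at its infimum by continuity, and
    [box_extend] carries the identity past the infimum unless that is 0. *)
Lemma gamma_nbhs0 theta : gamma_nbhs theta -> affine p 0 = 1 -> gamma_nbhs 0.
Proof.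
move=> gth p0.
pose E := [set u : R | 0 <= u <= 1 /\ forall v, u <= v <= 1 -> gamma_nbhs (v *: theta)].
have E1 : E 1.
  split; first by rewrite ler01 lexx.
  by move=> v hv; rewrite (@le_anti _ _ v 1) ?scale1r// andbC.
have lbE : has_lbound E by exists 0 => u [/andP[]].
have infE : has_inf E by split => //; exists 1.
set u := inf E.
have u0 : 0 <= u by apply: lb_le_inf => //; [exists 1|move=> v [/andP[]]].
have u1 : u <= 1 by apply: ge_inf.
have Ev v : u < v -> exists2 w, E w & w < v.
  move=> uv; have vu : 0 < v - u by rewrite subr_gt0.
  by have [w Ew] := inf_adherent vu infE; rewrite subrKC => h; exists w.
pose M : R := 1 + (affine p theta) `^ (- l).
have [th0 thE] := gamma_nbhs_pt gth.
have M0 : 0 < M by rewrite ltr_pwDl// powR_ge0.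
(* The solution of m^(-l) = M, where [M] bounds the transform on the segment by [lap_scale_le]. *)
pose m := (M^-1) `^ (l^-1).
have m0 : 0 < m by rewrite powR_gt0 // invr_gt0.
have mE v : E v -> m <= affine p (v *: theta).
  move=> [/andP[v0 v1] /(_ v)]; rewrite lexx v1 => /(_ isT)/gamma_nbhs_pt[q0 qE].
  have := @lap_scale_le v theta; rewrite v0 v1 qE thE => /(_ isT).
  rewrite -EFinD lee_fin -/M powRN => h.
  rewrite leNgt; apply/negP => lt.
  have := gt0_ltr_powR l0 (ltW q0) (ltW m0) lt.
  rewrite /m -powRrM mulVf ?gt_eqF// powRr1 ?invr_ge0 ?(ltW M0)// => lt2.
  have := lt_le_trans _ h.
  have : M < (affine p (v *: theta) `^ l)^-1.
    by rewrite -[ltLHS]invrK ltf_pV2// posrE ?invr_gt0// powR_gt0.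
  by move=> /lt_le_trans/(_ h); rewrite ltxx.
have near_u (e : R) : 0 < e -> exists v, E v /\ box (u *: theta) e (v *: theta).
  move=> e0; pose B := 1 + \sum_i `|theta 0 i|.
  have B0 : 0 < B by rewrite ltr_pwDl// sumr_ge0.
  have [|v Ev1 vu] := Ev (u + e / B); first by rewrite ltrDl divr_gt0.
  exists v; split => // i; rewrite !mxE -mulrBl normrM.
  have uv : u <= v by apply: ge_inf.
  rewrite ger0_norm ?subr_ge0//.
  have iB : `|theta 0 i| < B.
    rewrite /B (bigD1 i)//= addrCA ltrDl ltr_pwDl// sumr_ge0//.
  move: vu; rewrite -ltrBlDl ltr_pdivlMr// => vu; apply: le_lt_trans vu.
  by rewrite ler_wpM2l ?subr_ge0// ltW.
have pu : 0 < affine p (u *: theta).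
  rewrite ltNge; apply/negP => pu0.
  have /nbhs_box[e e0 He] : nbhs (u *: theta) [set eta | affine p eta < m].
    have := @affine_continuous R n p (u *: theta).
    move=> /cvgr_lt; apply; exact: le_lt_trans pu0 m0.
  have [v [Ev1 bv]] := near_u _ e0.
  by have := lt_le_trans (He _ bv) (mE _ Ev1); rewrite ltxx.
have /nbhs_box[e e0 He] : nbhs (u *: theta) [set eta | 0 < affine p eta].
  have := @affine_continuous R n p (u *: theta).
  by move=> /cvgr_gt; apply.
have [v [Ev1 bv]] := near_u _ e0.
have gv : gamma_nbhs (v *: theta).
  by case: Ev1 => /andP[_ v1] /(_ v); rewrite lexx v1; exact.
have boxg := box_extend He bv gv.
have gb : forall e', e' < e -> 0 < e' -> forall eta, box (u *: theta) e' eta -> gamma_nbhs eta.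
  move=> e' e'e e'0 eta be; apply/nbhs_box; exists (e - e'); first by rewrite subr_gt0.
  move=> eta' be'; apply: boxg => i.
  have := ler_normD (eta' 0 i - eta 0 i) (eta 0 i - (u *: theta) 0 i).
  by rewrite addrA subrK => h; have := be i; have := be' i; lra.
have [u00|u0'] := eqVneq u 0.
  have := gb (e / 2); rewrite u00 scale0r; apply; rewrite ?divr_gt0//; first lra.
  by move=> i; rewrite subrr normr0 divr_gt0.
(* For u > 0 the smaller number u - h would also lie in [E]. The minimum defining [h] keeps u - h
   nonnegative and the added points within the box of radius e / 2. *)
exfalso.
have ugt0 : 0 < u by rewrite lt_neqAle eq_sym u0'.
pose B := 1 + \sum_i `|theta 0 i|.
have B0 : 0 < B by rewrite ltr_pwDl// sumr_ge0.
pose h := Num.min u (e / 4 / B).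
have h0 : 0 < h by rewrite lt_min ugt0 !divr_gt0.
have iB i : `|theta 0 i| < B.
  by rewrite /B (bigD1 i)//= addrCA ltrDl ltr_pwDl// sumr_ge0.
suff : E (u - h).
  by move=> /(ge_inf lbE); rewrite -/u lerBrDl gerDr leNgt h0.
split.
  by rewrite subr_ge0 ge_min lexx /= (le_trans _ u1)// gerBl ltW.
move=> w /andP[w1 w2].
have [wu|uw] := leP w (u + h); last first.
  have [|w' Ew' w'w] := Ev w; first by apply: lt_trans uw; rewrite ltrDl.
  by case: Ew' => _ /(_ w); apply; rewrite (ltW w'w).
apply: (gb (e / 2)); rewrite ?divr_gt0//; first lra.
move=> i; rewrite !mxE -mulrBl normrM.
have wh : `|w - u| <= h by rewrite ler_distl; lra.
have hB : h * B <= e / 4 by rewrite -ler_pdivlMr// ge_min lexx orbT.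
apply: (@le_lt_trans _ _ (h * B)); last by lra.
by rewrite ler_pM ?normr_ge0// ltW.
Qed.

End Continuation.

(** * The sign of a coordinate from the slope along its axis *)

Section SignLine.
Context {R : realType} {d : measure_display} {T : measurableType d}.
Variables (mu : {measure set T -> \bar R}).
Implicit Types (Y Z : T -> R).
Local Open Scope classical_set_scope.

(** Since e^(-mY) >= m max(-Y, 0) where Y < 0, the integral of max(-Y, 0) against the weight at
    [s1], multiplied by any natural m, stays below [K]. It is therefore 0. *)
Lemma lapline_bounded_ge0 Y Z (s1 K : R) :
  measurable_fun [set: T] Y -> measurable_fun [set: T] Z ->
  (forall s, s1 <= s -> (lapline mu Y Z s <= K%:E)%E) ->
  {ae mu, forall w, 0 <= Y w}.
Proof.
move=> mY mZ bd.
pose g w := Num.max (- Y w) 0 * tilt Y Z s1 w.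
have mt s : measurable_fun [set: T] (tilt Y Z s) by exact: measurable_tilt.
have mg : measurable_fun [set: T] g.
  apply: measurable_funM => //; apply: measurable_maxr; last exact: measurable_cst.
  exact: measurable_funN.
have g0 w : 0 <= g w by rewrite mulr_ge0 ?tilt_ge0// le_max lexx orbT.
have mge m : (m%:R%:E * \int[mu]_w (g w)%:E <= K%:E)%E.
  rewrite -ge0_integralZl//; last 2 first.
  - exact/measurable_EFinP.
  - by move=> w _; rewrite lee_fin.
  apply: le_trans (bd (s1 + m%:R) _); last by rewrite lerDl.
  apply: ge0_le_integral => //.
  - by move=> w _; rewrite mule_ge0// lee_fin.
  - by apply: emeasurable_funM; [exact: measurable_cst|exact/measurable_EFinP].
  - exact/measurable_EFinP.
  move=> w _; rewrite -EFinM lee_fin -(opprK m%:R) tilt_shift /g mulrA.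
  rewrite ler_wpM2r ?tilt_ge0//; have [Y0|Y0] := leP (- Y w) 0.
    by rewrite mulr0 expR_ge0.
  have := expR_ge1Dx (- m%:R * Y w); lra.
have I0 : (\int[mu]_w (g w)%:E = 0)%E.
  have Ige : (0 <= \int[mu]_w (g w)%:E)%E.
    by apply: integral_ge0 => w _; rewrite lee_fin.
  have If : (\int[mu]_w (g w)%:E \is a fin_num)%E.
    by rewrite ge0_fin_numE// (le_lt_trans _ (ltry K))// -[leLHS]mul1e; exact: (mge 1).
  apply/eqP; rewrite eq_le Ige andbT -(fineK If) lee_fin leNgt; apply/negP => I1.
  set I := fine _ in I1; have mgI m : m%:R * I <= K.
    by have := mge m; rewrite -(fineK If) -EFinM lee_fin.
  have K0 : 0 <= K by have := mgI 0%N; rewrite mul0r.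
  have := mgI (Num.bound (K / I)); rewrite -ler_pdivlMr// leNgt.
  by rewrite archi_boundP// divr_ge0// ltW.
have : ae_eq mu [set: T] (EFin \o g) (cst 0%E).
  apply/ae_eq_integral_abs => //; first exact/measurable_EFinP.
  by rewrite -[RHS]I0; apply: eq_integral => w _ /=; rewrite ger0_norm.
apply: filterS => w /(_ I) /= [] /eqP; rewrite mulf_eq0 (gt_eqF (tilt_gt0 _ _ _ _)) orbF.
by move=> /eqP h; rewrite -oppr_le0 -h le_max lexx.
Qed.

Lemma lapline_opp Y Z s : lapline mu (fun w => - Y w) Z s = lapline mu Y Z (- s).
Proof.
by apply: eq_integral => w _; rewrite /tilt mulrN mulNr.
Qed.

(** With b >= 0 the base does not decrease beyond [s0], so its power -l stays bounded there. *)
Lemma gamma_ge0 Y Z (a b l s0 : R) : 0 < l ->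
  measurable_fun [set: T] Y -> measurable_fun [set: T] Z ->
  (forall s, 0 < a + b * s -> gamma_at mu Y Z a b l s) ->
  0 < a + b * s0 -> 0 <= b -> {ae mu, forall w, 0 <= Y w}.
Proof.
move=> l0 mY mZ H p0 b0.
apply: (@lapline_bounded_ge0 Y Z s0 ((a + b * s0) `^ (- l))) => // s s0s.
have le : a + b * s0 <= a + b * s by rewrite lerD2l ler_wpM2l.
have [p1 ->] := H s (lt_le_trans p0 le).
rewrite lee_fin !powRN lef_pV2 ?posrE ?powR_gt0//.
by apply: ge0_ler_powR; rewrite ?nnegrE ?(ltW l0) ?(ltW p0) ?(ltW p1).
Qed.

Lemma gamma_le0 Y Z (a b l s0 : R) : 0 < l ->
  measurable_fun [set: T] Y -> measurable_fun [set: T] Z ->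
  (forall s, 0 < a + b * s -> gamma_at mu Y Z a b l s) ->
  0 < a + b * s0 -> b <= 0 -> {ae mu, forall w, Y w <= 0}.
Proof.
move=> l0 mY mZ H p0 b0.
have : {ae mu, forall w, 0 <= - Y w}.
  apply: (@gamma_ge0 (fun w => - Y w) Z a (- b) l (- s0)) => //.
  - exact: measurable_funN.
  - move=> s ps; have [|p1 p2] := H (- s); first by rewrite mulrN -mulNr.
    by split => //; rewrite lapline_opp p2 mulrN mulNr.
  - by rewrite mulrNN.
  - by rewrite oppr_ge0.
by apply: filterS => w; rewrite oppr_ge0.
Qed.

(** If Y vanishes almost everywhere, the transform does not depend on s. Equality at two points of
    the interval gives b = 0, because powers with nonzero exponent are injective. *)
Lemma gamma_eq0 Y Z (a b l c e : R) : 0 < l -> c < e ->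
  measurable_fun [set: T] Y -> measurable_fun [set: T] Z ->
  (forall s, c < s < e -> gamma_at mu Y Z a b l s) ->
  {ae mu, forall w, Y w = 0} -> b = 0.
Proof.
move=> l0 ce mY mZ H Y0.
have cst s s' : lapline mu Y Z s = lapline mu Y Z s'.
  have mt t : measurable_fun [set: T] (EFin \o tilt Y Z t).
    exact/measurable_EFinP/measurable_tilt.
  apply: ae_eq_integral => //; first exact: mt.
    exact: mt.
  by apply: filterS Y0 => w Yw _; rewrite /tilt Yw !mulr0.
have [|p1 e1] := H (c + (e - c) / 3); first by lra.
have [|p2 e2] := H (c + (e - c) / 2); first by lra.
have := cst (c + (e - c) / 3) (c + (e - c) / 2); rewrite e1 e2 => -[].
rewrite !powRN => /invr_inj /powR_injective - /(_ l0); rewrite !nnegrE.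
move=> /(_ (ltW p1) (ltW p2)) E.
have /eqP : b * (e - c) = 0 by lra.
by rewrite mulf_eq0 subr_eq0 (gt_eqF ce) orbF => /eqP.
Qed.

End SignLine.

(** * The identity on the closed orthant *)

Section Orthant.
Context {R : realType} {d : measure_display} {T : measurableType d} {n : nat}.
Variables (mu : probability T R) (x : 'I_n -> T -> R).
Hypothesis mx : forall i, measurable_fun [set: T] (x i).
Variables (p : {set 'I_n} -> R) (l : R).
Hypothesis l0 : 0 < l.
Local Open Scope classical_set_scope.
Implicit Types (theta eta : 'rV[R]_n) (j : 'I_n).

Let gpt := gamma_pt mu x p l.

Definition line_ok theta j : Prop :=
  exists c e : R, c < e /\ forall s, c < s < e -> gpt (upd theta j s).

Lemma line_ok_at theta j : line_ok theta j -> forall s,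
  0 < intercept p theta j + slope p theta j * s ->
  gamma_at mu (x j) (others x theta j) (intercept p theta j) (slope p theta j) l s.
Proof.
move=> [c [e [ce H]]] s pos; apply/gamma_pt_upd.
by apply: (line_extend mx l0 ce H); rewrite affine_upd.
Qed.

Lemma line_ok_pos theta j : line_ok theta j ->
  exists s, 0 < intercept p theta j + slope p theta j * s.
Proof.
move=> [c [e [ce H]]]; exists ((c + e) / 2).
by have [] := H ((c + e) / 2); [lra|rewrite affine_upd].
Qed.

Lemma line_ok_ge0 theta j : line_ok theta j -> 0 <= slope p theta j ->
  {ae mu, forall w, 0 <= x j w}.
Proof.
move=> ok b0; have [s ps] := line_ok_pos ok.
apply: (gamma_ge0 l0 (mx j) (measurable_others mx theta j) (line_ok_at ok) ps b0).
Qed.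

(** A positive slope at [theta] gives x_j >= 0 and a nonpositive one at [eta] gives x_j <= 0.
    Together they make x_j null, which forces slope 0 at [theta]. *)
Lemma line_ok_slope theta eta j : line_ok theta j -> line_ok eta j ->
  0 < slope p theta j -> 0 < slope p eta j.
Proof.
move=> ok1 ok2 b1; rewrite ltNge; apply/negP => b2.
have Y1 := line_ok_ge0 ok1 (ltW b1).
have [s ps] := line_ok_pos ok2.
have Y2 := gamma_le0 l0 (mx j) (measurable_others mx eta j) (line_ok_at ok2) ps b2.
have Y0 : {ae mu, forall w, x j w = 0}.
  by apply: filterS2 Y1 Y2 => w h1 h2; apply/le_anti/andP.
have [c [e [ce H]]] := ok1.
have G s' : c < s' < e -> gamma_at mu (x j) (others x theta j)
    (intercept p theta j) (slope p theta j) l s'.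
  by move=> hs; apply/gamma_pt_upd/H.
have := gamma_eq0 l0 ce (mx j) (measurable_others mx theta j) G Y0.
by move=> b0; rewrite b0 ltxx in b1.
Qed.

Hypothesis p0 : p finset.set0 = 1.
Hypothesis ppos : forall j : nat, (1 <= j <= n)%N ->
  0 < p [set i : 'I_n | (i < j)%N]%SET.

(** Induction on [k]: the first k coordinates range over [0, oo) and the others over (-r, r). The
    next slope is positive at one point by [slope_gt0_large], hence at all relevant ones by
    [line_ok_slope], so P stays positive as that coordinate grows. *)
Lemma gamma_orthant theta0 : gamma_nbhs mu x p l theta0 ->
  [/\ forall theta, (forall i, 0 <= theta 0 i) -> gpt theta,
      forall j, {ae mu, forall w, 0 <= x j w} &
      forall theta j, (forall i, 0 <= theta 0 i) -> 0 < slope p theta j].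
Proof.
move=> g0; have pa0 : affine p 0 = 1 by rewrite affine0.
have /nbhs_box[r r0 Hr] := gamma_nbhs0 mx l0 g0 pa0.
suff main k : (k <= n)%N ->
    (forall theta, (forall i : 'I_n, (i < k)%N -> 0 <= theta 0 i) ->
      (forall i : 'I_n, (k <= i)%N -> `|theta 0 i| < r) -> gpt theta) /\
    (forall j : 'I_n, (j < k)%N ->
      exists2 eta, line_ok eta j & 0 < slope p eta j).
  have [A B] := main n (leqnn n).
  have A' theta : (forall i, 0 <= theta 0 i) -> gpt theta.
    by move=> h; apply: A => // i; rewrite leqNgt ltn_ord.
  split => //.
  - move=> j; have [|eta ok b] := B j; first exact: ltn_ord.
    exact: line_ok_ge0 ok (ltW b).
  - move=> theta j h; have [|eta ok b] := B j; first exact: ltn_ord.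
    apply: line_ok_slope ok _ b; exists 0, 1; split => // s /andP[s0 _].
    by apply: A' => i; rewrite updE; case: eqP => // _; exact: ltW.
elim: k => [|k ih] kn.
  split => // theta _ h; apply: Hr => i; rewrite mxE subr0; exact: h.
have [A B] := ih (ltnW kn); pose j := Ordinal kn.
have ok theta : (forall i : 'I_n, (i < k)%N -> 0 <= theta 0 i) ->
    (forall i : 'I_n, (k < i)%N -> `|theta 0 i| < r) ->
    forall s, `|s| < r -> gpt (upd theta j s).
  move=> h1 h2 s sr; apply: A => i ik; rewrite updE; case: eqP => [ij|ij].
  - by rewrite ij ltnn in ik.
  - exact: h1.
  - by [].
  - apply: h2; rewrite ltn_neqAle ik andbT; apply/eqP => e.
    by apply: ij; apply/val_inj.
have lok theta : (forall i : 'I_n, (i < k)%N -> 0 <= theta 0 i) ->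
    (forall i : 'I_n, (k < i)%N -> `|theta 0 i| < r) -> line_ok theta j.
  move=> h1 h2; exists (- r), r; split; first lra.
  by move=> s hs; apply: ok => //; rewrite ltr_norml.
have [eta oke be] : exists2 eta, line_ok eta j & 0 < slope p eta j.
  have jJ : j \notin [set i : 'I_n | (i < k)%N]%SET by rewrite inE ltnn.
  (* Indices start at 0, so adding index [k] to those below it gives the set [k + 1] of the
     hypothesis. *)
  have pJ : 0 < p (j |: [set i : 'I_n | (i < k)%N]%SET)%SET.
    rewrite (_ : j |: _ = [set i : 'I_n | (i < k.+1)%N]%SET); first exact: ppos.
    by apply/finset.setP => i; rewrite !inE ltnS [in RHS]leq_eqVlt.
  have [t t0 bt] := slope_gt0_large jJ pJ.
  exists (\row_i (if i \in [set i : 'I_n | (i < k)%N]%SET then t else 0)) => //.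
  apply: lok => i ik; rewrite mxE inE.
    by rewrite ik.
  by rewrite ltnNge (ltnW ik) normr0.
split; last first.
  move=> i; rewrite ltnS leq_eqVlt => /orP[/eqP ik|]; last exact: B.
  by exists eta => //; rewrite (_ : i = j)//; apply/val_inj.
move=> theta h1 h2; have okt : line_ok theta j.
  by apply: lok => i ik; [apply: h1; exact: ltnW|exact: h2].
have b0 := line_ok_slope oke okt be.
rewrite -(upd_id theta j); apply/gamma_pt_upd/(line_ok_at okt).
have [a0 _] : gpt (upd theta j 0).
  apply: ok; rewrite ?normr0// => i ik; apply: h1; exact: ltnW.
rewrite affine_upd mulr0 addr0 in a0.
by rewrite ltr_wpDr// mulr_ge0// ?(ltW b0)//; apply: h1.
Qed.

End Orthant.

(** * The image under Z of a measure with density *)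

Section DensityLaw.
Context {R : realType} {d : measure_display} {T : measurableType d}.
Variables (mu : {measure set T -> \bar R}) (Z U : T -> R).
Hypotheses (mZ : measurable_fun [set: T] Z) (mU : measurable_fun [set: T] U).
Hypothesis U0 : forall w, 0 <= U w.
Local Open Scope classical_set_scope.

(* The hypotheses are arguments so that the measure structure can be declared. *)
Definition density_law of measurable_fun [set: T] Z & measurable_fun [set: T] U
    & (forall w, 0 <= U w) := fun B : set R =>
  (\int[mu]_(w in Z @^-1` B) (U w)%:E)%E.

Let nu := density_law mZ mU U0.

Let nu0 : nu set0 = 0%E.
Proof. by rewrite /nu /density_law preimage_set0 integral_set0. Qed.

Let nu_ge0 B : (0 <= nu B)%E.
Proof. by apply: integral_ge0 => w _; rewrite lee_fin. Qed.

Let nu_sigma_additive : semi_sigma_additive nu.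
Proof.
move=> F mF tF mUF; rewrite /nu /density_law preimage_bigcup ge0_integral_bigcup.
- apply: is_cvg_nneseries => k _ _; exact: nu_ge0.
- by move=> k; rewrite -[X in measurable X]setTI; exact: mZ.
- exact/measurable_EFinP/measurable_funTS.
- by move=> w _; rewrite lee_fin.
- apply/trivIsetP => i j _ _ ij; rewrite -preimage_setI.
  by move/trivIsetP : tF => /(_ _ _ _ _ ij) ->//; rewrite preimage_set0.
Qed.

HB.instance Definition _ := isMeasure.Build _ _ _ nu nu0 nu_ge0 nu_sigma_additive.

Definition density_measure : {measure set R -> \bar R} := nu.

Lemma density_measureE B :
  density_measure B = (\int[mu]_(w in Z @^-1` B) (U w)%:E)%E.
Proof. by []. Qed.

End DensityLaw.

(** * Polynomials in e^(-z) approximating the indicator of a ray *)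

Section ThresholdPolynomials.
Context {R : realType}.
Local Open Scope classical_set_scope.
Implicit Types (n : nat) (z : R).

(** About n e^(n (z0 + 1)). Times e^(-n (z + 1)) it is about n e^(n (z0 - z)), which tends to 0 for
    z > z0 and is at least n otherwise. *)
Definition threshold_exp z0 n : nat := (Num.truncn (n%:R * expR (n%:R * (z0 + 1)) : R)).+1.

(* In e^(-z) this is a polynomial, and as n grows it tends to 1 for z > z0 and to 0
   for z <= z0. *)
Definition threshold z0 n z : R :=
  (1 - expR (- (n%:R * (z + 1)))) ^+ threshold_exp z0 n.

Lemma threshold_expP z0 n :
  n%:R * expR (n%:R * (z0 + 1)) <= (threshold_exp z0 n)%:R
    <= n%:R * expR (n%:R * (z0 + 1)) + 1.
Proof.
have y0 : 0 <= n%:R * expR (n%:R * (z0 + 1)) by rewrite mulr_ge0 ?expR_ge0.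
have /andP[h1 h2] := truncn_itv y0; rewrite /threshold_exp (ltW h2) /=.
by rewrite -natr1 lerD2r.
Qed.

Lemma threshold_itv z0 n z : 0 <= z -> 0 <= threshold z0 n z <= 1.
Proof.
move=> z1; have h : expR (- (n%:R * (z + 1))) <= 1.
  by rewrite expR_le1 oppr_le0 mulr_ge0// addr_ge0.
by rewrite exprn_ge0 ?subr_ge0//= exprn_ile1 ?subr_ge0// gerBl expR_ge0.
Qed.

Lemma bernoulli_le (y : R) n : 0 <= y <= 1 -> 1 - n%:R * y <= (1 - y) ^+ n.
Proof.
move=> /andP[y0 y1]; elim: n => [|n ih]; first by rewrite mul0r subr0 expr0.
have : (1 - n%:R * y) * (1 - y) <= (1 - y) ^+ n.+1.
  by rewrite exprSr ler_wpM2r// subr_ge0.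
apply: le_trans; rewrite -natr1.
have : 0 <= n%:R * y * y by rewrite !mulr_ge0.
nra.
Qed.

Lemma cvg_harmonic_scale (c : R) : c * n.+1%:R^-1 @[n --> \oo] --> 0.
Proof. by rewrite -[X in _ --> X](mulr0 c); apply: cvgMl_tmp; exact: cvg_harmonic. Qed.

Lemma expR_inv_le (y : R) : 0 < y -> expR (- y) <= y^-1.
Proof.
move=> y0; rewrite expRN lef_pV2 ?posrE ?expR_gt0//.
by apply: le_trans (expR_ge1Dx y); rewrite lerDr.
Qed.

Lemma expR_inv_sq_le (y : R) : 0 < y -> y * expR (- y) <= 2 * y^-1.
Proof.
move=> y0; rewrite expRN ler_pdivrMr ?expR_gt0//.
have h : 1 + y ^+ 2 / 2 <= expR y by exact: (@expR_ge1Dxn R y 1 (ltW y0)).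
rewrite [leLHS](_ : y = 2 * y^-1 * (y ^+ 2 / 2)); last by field; rewrite gt_eqF.
by rewrite ler_pM2l ?mulr_gt0 ?invr_gt0//; lra.
Qed.

(** For z > z0 Bernoulli's inequality gives a lower bound 1 - c / n. For z <= z0 the inequality 1 -
    y <= e^(-y) gives an upper bound e^(-n) <= 1 / n. *)
Lemma threshold_cvg z0 z : 0 <= z ->
  threshold z0 n z @[n --> \oo] --> (if z0 < z then 1 else 0 : R).
Proof.
move=> z1; have z11 : 0 < z + 1 by rewrite ltr_wpDl.
rewrite -(cvg_shiftS (threshold z0 ^~ z)).
have npos n : 0 < n.+1%:R :> R by rewrite ltr0n.
have e01 n : 0 <= expR (- (n%:R * (z + 1))) <= 1.
  by rewrite expR_ge0 expR_le1 oppr_le0 mulr_ge0// ltW.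
case: ltP => zz.
  set t := z - z0; have t0 : 0 < t by rewrite subr_gt0.
  (* The first term comes from n e^(-n t) <= 2 / (n t^2), the second from rounding the exponent
     up. *)
  pose c := 2 / t / t + (z + 1)^-1.
  apply: (@squeeze_cvgr _ _ _ _ (fun n => 1 - c * n.+1%:R^-1) (fun=> 1)); last 2 first.
  - have := cvgB (cvg_cst (1 : R)) (cvg_harmonic_scale c).
    by rewrite subr0; apply.
  - exact: cvg_cst.
  apply: nearW => n; have /andP[_ ->] := threshold_itv z0 n.+1 z1; rewrite andbT.
  apply: le_trans (bernoulli_le _ (e01 n.+1)); rewrite lerD2l lerN2.
  have /andP[_ h] := threshold_expP z0 n.+1.
  apply: le_trans (ler_wpM2r (expR_ge0 _) h) _.
  rewrite mulrDl mul1r /c mulrDl lerD//.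
    rewrite -[leLHS]mulrA -expRD -mulrBr opprD addrACA subrr addr0 -opprB -/t mulrN.
    have := expR_inv_sq_le (mulr_gt0 (npos n) t0).
    move=> h2; rewrite -(ler_pM2l t0) mulrA (mulrC t); apply: le_trans h2 _.
    by rewrite invfM le_eqVlt; apply/orP; left; apply/eqP; field; rewrite gt_eqF//= gt_eqF.
  rewrite -invfM mulrC; exact/expR_inv_le/mulr_gt0.
apply: (@squeeze_cvgr _ _ _ _ (fun=> 0) (fun n => 1 * n.+1%:R^-1)); last 2 first.
- exact: cvg_cst.
- exact: cvg_harmonic_scale.
apply: nearW => n; have /andP[-> _] := threshold_itv z0 n.+1 z1; rewrite mul1r /=.
apply: le_trans (expR_inv_le (npos n)).
set y := expR (- (n.+1%:R * (z + 1))).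
apply: (@le_trans _ _ (expR (- y) ^+ threshold_exp z0 n.+1)).
  have /andP[_ y1] := e01 n.+1.
  rewrite lerXn2r ?nnegrE ?expR_ge0 ?subr_ge0//; exact: expR_ge1Dx.
rewrite -expRM_natl ler_expR mulrN lerN2.
have /andP[h _] := threshold_expP z0 n.+1.
apply: le_trans (ler_wpM2r (expR_ge0 _) h).
rewrite -mulrA -expRD -mulrBr opprD addrACA subrr addr0 ler_peMr//.
by rewrite -expR0 ler_expR mulr_ge0// subr_ge0.
Qed.

End ThresholdPolynomials.

(** * Densities determined by Laplace transforms at the natural numbers *)

Section LaplaceUnique.
Context {R : realType} {d : measure_display} {T : measurableType d}.
Variables (mu : {measure set T -> \bar R}) (Z : T -> R).
Hypothesis mZ : measurable_fun [set: T] Z.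
Hypothesis Z0 : {ae mu, forall w, 0 <= Z w}.
Local Open Scope classical_set_scope.

Definition exp_moment (U : T -> R) (k : nat) : \bar R :=
  (\int[mu]_w (expR (- (k%:R * Z w)) * U w)%:E)%E.

Lemma measurable_expZ (c e : R) : measurable_fun [set: T] (fun w => expR (- (c * (Z w + e)))).
Proof.
apply: measurableT_comp => //; apply: measurable_funN.
by apply: measurable_funM; [|apply: measurable_funD] => //; exact: measurable_cst.
Qed.

Section OneDensity.
Variable U : T -> R.
Hypotheses (mU : measurable_fun [set: T] U) (U0 : forall w, 0 <= U w).
Hypothesis Ufin : forall k, (exp_moment U k < +oo)%E.

Lemma integrable_exp_moment k :
  mu.-integrable [set: T] (fun w => (expR (- (k%:R * Z w)) * U w)%:E).
Proof.
apply/integrableP; split.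
  apply/measurable_EFinP; apply: measurable_funM => //.
  have := measurable_expZ k%:R 0.
  by apply: eq_measurable_fun => w _; rewrite addr0.
apply: le_lt_trans (Ufin k); rewrite le_eqVlt; apply/orP; left; apply/eqP.
by apply: eq_integral => w _ /=; rewrite ger0_norm// mulr_ge0// expR_ge0.
Qed.

Lemma poly_exp_moment (q : {poly R}) :
  (\int[mu]_w (q.[expR (- Z w)] * U w)%:E =
   \sum_(i < size q) (q`_i)%:E * exp_moment U i)%E.
Proof.
have -> : (\int[mu]_w (q.[expR (- Z w)] * U w)%:E = \int[mu]_w
    \sum_(i < size q) (q`_i)%:E * (expR (- (i%:R * Z w)) * U w)%:E)%E.
  apply: eq_integral => w _; rewrite horner_coef mulr_suml -sumEFin.
  apply: eq_bigr => i _; rewrite -EFinM -mulrN expRM_natl.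
  by rewrite mulrA.
rewrite integral_sum//; last first.
  by move=> i; apply: integrableZl => //; exact: integrable_exp_moment.
apply: eq_bigr => i _; rewrite integralZl//; exact: integrable_exp_moment.
Qed.

(** Dominated convergence with majorant [U], as the threshold functions lie in [0, 1] wherever Z >=
    0. *)
Lemma threshold_integral_cvg z0 :
  (\int[mu]_w (threshold z0 n (Z w) * U w)%:E @[n --> \oo] -->
   \int[mu]_(w in Z @^-1` `]z0, +oo[) (U w)%:E)%E.
Proof.
have mU0 : mu.-integrable [set: T] (EFin \o U).
  have := integrable_exp_moment 0; apply: eq_integrable => // w _.
  by rewrite /= mul0r oppr0 expR0 mul1r.
rewrite integral_mkcond.
have mt n : measurable_fun [set: T] (fun w => (threshold z0 n (Z w) * U w)%:E).
  apply/measurable_EFinP; apply: measurable_funM => //; apply: measurable_funX.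
  by apply: measurable_funB; [exact: measurable_cst|exact: measurable_expZ].
have mr : measurable_fun [set: T] ((EFin \o U) \_ (Z @^-1` `]z0, +oo[)).
  apply/(measurable_restrictT (EFin \o U)).
    by rewrite -[X in measurable X]setTI; exact: mZ.
  by apply: measurable_funTS; exact/measurable_EFinP.
have ae1 : {ae mu, forall w, [set: T] w ->
    (threshold z0 n (Z w) * U w)%:E @[n --> \oo] -->
    ((EFin \o U) \_ (Z @^-1` `]z0, +oo[)) w}.
  apply: filterS Z0 => w Zw _.
  have -> : ((EFin \o U) \_ (Z @^-1` `]z0, +oo[)) w =
     ((if z0 < Z w then 1 else 0) * U w)%:E.
    rewrite /patch; case: ifPn; rewrite ?inE ?notin_setE /= in_itv /= andbT.
      by move=> ->; rewrite mul1r.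
    by move=> /negP/negbTE ->; rewrite mul0r.
  apply: cvg_EFin; first by apply: nearW.
  by apply: cvgMr_tmp; exact: threshold_cvg.
have ae2 : {ae mu, forall w n, [set: T] w ->
    (`|(threshold z0 n (Z w) * U w)%:E| <= (EFin \o U) w)%E}.
  apply: filterS Z0 => w Zw n _ /=; rewrite lee_fin normrM (ger0_norm (U0 w)).
  have /andP[h1 h2] := threshold_itv z0 n Zw.
  by rewrite ger0_norm// ler_piMl.
by have [_ _] := dominated_convergence measurableT mt mr ae1 mU0 ae2.
Qed.

End OneDensity.

(** Integrals of threshold polynomials are combinations of the exponential moments, so in the limit
    the two densities agree on every ray. Rays are stable under intersection and generate the Borel
    sets, and the masses are finite by the case k = 0. *)
Lemma laplace_unique (U V : T -> R) :
  measurable_fun [set: T] U -> measurable_fun [set: T] V ->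
  (forall w, 0 <= U w) -> (forall w, 0 <= V w) ->
  (forall k, (exp_moment U k < +oo)%E) -> exp_moment U = exp_moment V ->
  forall B : set R, measurable B ->
  (\int[mu]_(w in Z @^-1` B) (U w)%:E = \int[mu]_(w in Z @^-1` B) (V w)%:E)%E.
Proof.
move=> mU mV U0 V0 Ufin UV B mB.
have Vfin k : (exp_moment V k < +oo)%E by rewrite -UV.
have ray z0 : (\int[mu]_(w in Z @^-1` `]z0, +oo[) (U w)%:E =
    \int[mu]_(w in Z @^-1` `]z0, +oo[) (V w)%:E)%E.
  have cU := @threshold_integral_cvg U mU U0 Ufin z0.
  have cV := @threshold_integral_cvg V mV V0 Vfin z0.
  apply: (cvg_unique _ cU) => //; apply: cvg_trans cV.
  apply: near_eq_cvg; apply: nearW => n.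
  pose q : {poly R} := (1 - (expR (- n%:R))%:P * 'X^n) ^+ threshold_exp z0 n.
  have qE w : threshold z0 n (Z w) = q.[expR (- Z w)].
    rewrite /q /threshold !hornerE; congr ((1 - _) ^+ _).
    by rewrite -expRM_natl -expRD; congr expR; ring.
  under eq_integral do rewrite qE.
  under [RHS]eq_integral do rewrite qE.
  by rewrite !poly_exp_moment// UV.
pose G := [set A : set R | exists z0, A = `]z0, +oo[%classic].
apply: (@measure_unique _ _ _ G (fun k => `](- k%:R)%R, +oo[) _ _ _ _
  (density_measure mu mZ mU U0) (density_measure mu mZ mV V0)) => //.
- exact: RGenOInfty.measurableE.
- move=> _ _ [a ->] [b ->]; exists (Num.max a b).
  apply/seteqP; split => y /=; rewrite !in_itv /= !andbT gt_max.
    by move=> [-> ->].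
  by move=> /andP[].
- by move=> k; exists (- k%:R).
- rewrite -subTset => y _; exists (Num.bound `|- y|) => //=.
  rewrite in_itv /= andbT ltrNl; apply: le_lt_trans (ler_norm _) _.
  by apply: archi_boundP.
- by move=> _ [z0 ->]; exact: ray.
- move=> k; apply: le_lt_trans (Ufin 0%N); rewrite density_measureE.
  apply: (@le_trans _ _ (\int[mu]_w (U w)%:E)%E).
    apply: ge0_subset_integral => //.
    - by rewrite -[X in measurable X]setTI; exact: mZ.
    - exact/measurable_EFinP.
    - by move=> w _; rewrite lee_fin.
  by rewrite le_eqVlt; apply/orP; left; apply/eqP; apply: eq_integral => w _;
    rewrite mul0r oppr0 expR0 mul1r.
Qed.

End LaplaceUnique.

(** * Derivatives and Taylor's formula for affine polynomials *)

Section Taylor.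
Context {R : realType} {n : nat}.
Implicit Types (p q : {set 'I_n} -> R) (T U W : {set 'I_n}) (theta z : 'rV[R]_n).
Implicit Types (i j : 'I_n).

(** The coefficients of the mixed partial derivative over [U]: each monomial divisible by theta^U
    loses that factor and the others disappear. *)
Definition pshift U p : {set 'I_n} -> R :=
  fun T => if [disjoint T & U] then p (T :|: U) else 0.

Definition pshift1 i p : {set 'I_n} -> R :=
  fun T => if i \in T then 0 else p (i |: T).

Lemma slopeE q theta i : slope q theta i = affine (pshift1 i q) theta.
Proof.
rewrite /slope /affine big_mkcond; apply: eq_bigr => T _; rewrite /pshift1.
by case: (i \in T); rewrite ?mul0r.
Qed.

(** Along an axis the difference quotient is constant, equal to the slope. *)
Lemma derive_affine q i : 'D_(delta_mx 0 i) (affine q) = affine (pshift1 i q).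
Proof.
apply/funext => a; rewrite -slopeE.
apply: cvg_lim => //; apply: cvg_near_cst.
near=> h; have h0 : h != 0 by near: h; exact: nbhs_dnbhs_neq.
rewrite /=; have -> : h *: delta_mx 0 i + a = upd a i (h + a 0 i).
  apply/rowP => k; rewrite updE !mxE eqxx /=.
  by case: eqP => [->|_]; rewrite ?mulr1 ?mulr0 ?add0r.
rewrite affine_upd (affine_split q a i) /GRing.scale /=.
by field.
Unshelve. all: by end_near. Qed.

Lemma foldr_pshift1 p (s : seq 'I_n) T : uniq s ->
  foldr pshift1 p s T = if has (mem T) s then 0 else p (T :|: [set k in s])%SET.
Proof.
elim: s T => [|i s ih] T /=.
  by move=> _; congr p; apply/finset.setP => k; rewrite !inE orbF.
move=> /andP[is_ us]; rewrite /pshift1 -/pshift1; case: ifPn => //= iT.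
rewrite ih//; have -> : has (mem (i |: T)) s = has (mem T) s.
  apply: eq_in_has => k ks; rewrite !inE; case: eqP => // ki.
  by rewrite -ki ks in is_.
case: ifP => // _; congr p; apply/finset.setP => k; rewrite !inE.
by case: (k == i); rewrite ?orbT.
Qed.

Lemma partials_affine U p : partials U (affine p) = affine (pshift U p).
Proof.
have -> : partials U (affine p) = affine (foldr pshift1 p (enum U)).
  rewrite /partials; elim: (enum U) => //= i s ->.
  by rewrite derive_affine.
congr affine; apply/funext => T; rewrite foldr_pshift1 ?enum_uniq// /pshift.
have -> : has (mem T) (enum U) = ~~ [disjoint T & U].
  apply/hasP/idP => [[k kU kT]|].
    apply/negP => /pred0P/(_ k) /=; rewrite -(mem_enum (mem U)) kU.
    by have -> : k \in T by [].
  rewrite -finset.setI_eq0 => /set0Pn[k]; rewrite inE => /andP[kT kU].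
  by exists k => //; rewrite mem_enum.
rewrite if_neg; case: ifP => // _; congr p.
by apply/finset.setP => k; rewrite !inE mem_enum.
Qed.

Lemma monomD theta z W : monom (theta + z) W =
  \sum_(U : {set 'I_n} | U \subset W) monom z U * monom theta (W :\: U).
Proof.
(* Outside [W] the factors are 0 and 1, so the product runs over all indices and only subsets of [W]
   survive its expansion. *)
pose F i := if i \in W then z 0 i else 0.
pose G i := if i \in W then theta 0 i else 1.
have -> : monom (theta + z) W = \prod_i (F i + G i).
  rewrite /monom big_mkcond /=; apply: eq_bigr => i _; rewrite /F /G mxE.
  by case: ifP => _; rewrite ?add0r// addrC.
rewrite bigA_distr [RHS]big_mkcond /=; apply: eq_bigr => U _.
case: ifPn => [UW|/fintype.subsetPn[i iU iW]]; last first.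
  by rewrite (bigD1 i)//= iU /F (negbTE iW) mul0r.
rewrite /monom [X in _ = X * _]big_mkcond [X in _ = _ * X]big_mkcond -big_split /=.
apply: eq_bigr => i _; rewrite !inE /F /G; case: ifPn => iU /=.
  by rewrite (fintype.subsetP UW)// mulr1.
by rewrite mul1r.
Qed.

(** Expanding each monomial and writing W as the disjoint union of T and U collects the coefficients
    of z^U into the derivative over U. *)
Lemma affine_taylor p theta z : affine p (theta + z) =
  \sum_(U : {set 'I_n}) partials U (affine p) theta * monom z U.
Proof.
rewrite /affine (eq_bigr (fun W => \sum_(U : {set 'I_n})
    (if U \subset W then p W * monom z U * monom theta (W :\: U) else 0))); last first.
  move=> W _; rewrite monomD mulr_sumr big_mkcond; apply: eq_bigr => U _.
  by case: ifP => // _; rewrite mulrA.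
rewrite exchange_big; apply: eq_bigr => U _ /=; rewrite partials_affine /affine.
rewrite -big_mkcond /= (reindex_onto (fun T => T :|: U) (fun W => W :\: U)) /=; last first.
  move=> W UW; apply/finset.setP => k; rewrite !inE.
  case: (boolP (k \in U)) => kU /=; last by rewrite orbF.
  by rewrite (fintype.subsetP UW k kU).
rewrite mulr_suml big_mkcond [RHS]big_mkcond; apply: eq_bigr => T _ /=.
have -> : (U \subset T :|: U) && ((T :|: U) :\: U == T) = [disjoint T & U].
  rewrite finset.subsetUr /= finset.setDUl finset.setDv finset.setU0.
  by apply/eqP/finset.setDidPl.
rewrite /pshift; case: ifP => dTU; last by rewrite !mul0r.
have -> : (T :|: U) :\: U = T.
  by rewrite finset.setDUl finset.setDv finset.setU0; apply/finset.setDidPl.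
by ring.
Qed.

End Taylor.

(** * The coefficients r_T and the Taylor expansion at theta_P *)

Section RCoefficients.
Context {R : realType} {n : nat}.
Variables (p : {set 'I_n} -> R) (i1 : 'I_n).
Hypothesis hp : forall T : {set 'I_n}, p T != 0.
Implicit Types (T U : {set 'I_n}) (theta : 'rV[R]_n).

Let N : {set 'I_n} := [set~ i1]%SET.
Let pn := p [set: 'I_n]%SET.

Lemma ptilde_neq0 T : ptilde p T != 0.
Proof. by rewrite /ptilde mulf_neq0 ?invr_eq0// oppr_eq0. Qed.

Lemma subC1 T : (T \subset N) = (i1 \notin T).
Proof. by rewrite /N finset.subsetC finset.sub1set inE. Qed.

Lemma SN_slope theta : SN p i1 theta = slope p theta i1 / p [set i1]%SET.
Proof.
rewrite /SN /slope mulr_suml (eq_bigl _ _ subC1).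
by apply: eq_bigr => T _; rewrite mulrAC.
Qed.

Lemma zero_at_upd theta : zero_at i1 theta = upd theta i1 0.
Proof. by apply/rowP => i; rewrite !mxE. Qed.

(** Factor by factor, (-ptilde_i) S_i(theta_i) = theta_i - ptilde_i: the increment from theta_P. *)
Lemma monom_shift theta U :
  monom (- thetaP p) U * monom (Svec p theta) U = monom (theta - thetaP p) U.
Proof.
rewrite /monom -big_split /=; apply: eq_bigr => i _; rewrite !mxE.
by field; exact: ptilde_neq0.
Qed.

(** Taylor's formula at theta_P for the point whose first coordinate is ptilde_1. The increment has
    first coordinate 0, so only subsets of N contribute; they are written N \ T, the complement of
    {1} and T together. *)
Lemma rcoef_sum theta :
  \sum_(T : {set 'I_n} | T \subset N)
     rcoef p (i1 |: T)%SET * monom (- thetaP p) (N :\: T)%SET *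
     monom (Svec p theta) (N :\: T)%SET =
  - pn^-1 * (intercept p theta i1 + slope p theta i1 * ptilde p [set i1]%SET).
Proof.
rewrite -affine_upd; set z := upd (theta - thetaP p) i1 0.
have -> : upd theta i1 (ptilde p [set i1]%SET) = thetaP p + z.
  apply/rowP => i; rewrite !mxE; case: eqP => [->|_]; first by rewrite addr0.
  by rewrite addrC subrK.
rewrite affine_taylor [in RHS](bigID (fun U : {set 'I_n} => U \subset N)) /=.
rewrite [in RHS]addrC [X in _ * (X + _)]big1 ?add0r; last first.
  move=> U; rewrite subC1 negbK => iU.
  by rewrite /monom (bigD1 i1)//= /z updE eqxx mul0r mulr0.
rewrite [in RHS](reindex_onto (fun T => N :\: T)%SET (fun T => N :\: T)%SET) /=; last first.
  by move=> T TN; rewrite finset.setDDr finset.setDv finset.set0U; apply/finset.setIidPr.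
rewrite mulr_sumr; apply: eq_big => [T|T TN].
  rewrite finset.subsetDl /= finset.setDDr finset.setDv finset.set0U.
  by apply/idP/eqP => [/finset.setIidPr|/finset.setIidPr].
rewrite -mulrA monom_shift /rcoef; have -> : (~: (i1 |: T) = N :\: T)%SET.
  by apply/finset.setP => k; rewrite !inE negb_or andbC.
rewrite monom_upd ?mulrA// !inE eqxx /= andbF//.
Qed.

(** Differentiating P in all directions of N leaves p_[n] theta_1 plus a constant, as does the
    definition's derivative over the complement of {1}; here the constant is p_N, and ptilde_1 is
    the root. *)
Lemma rcoef1 : rcoef p [set i1]%SET = 0.
Proof.
rewrite /rcoef partials_affine (affine_split _ _ i1).
have iE : intercept (pshift (~: [set i1]) p) (thetaP p) i1 = p N.
  rewrite /intercept (bigD1 finset.set0) ?inE//= big1 ?addr0.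
    by rewrite /pshift finset.disjoints_subset finset.sub0set finset.set0U /monom big_set0 mulr1.
  move=> T /andP[iT T0]; rewrite /pshift; case: ifP => [dT|_]; last by rewrite mul0r.
  move: T0; rewrite -finset.subset0; case/negP; apply/fintype.subsetP => k kT.
  have : k \in [set i1]%SET.
    by move: dT; rewrite finset.disjoints_subset finset.setCK => /fintype.subsetP/(_ k kT).
  by rewrite inE => /eqP ki; rewrite -ki kT in iT.
have sE : slope (pshift (~: [set i1]) p) (thetaP p) i1 = pn.
  rewrite /slope (bigD1 finset.set0) ?inE//= big1 ?addr0.
    rewrite finset.setU0 /pshift finset.disjoints_subset finset.setCK subxx finset.setUCr.
    by rewrite /monom big_set0 mulr1.
  move=> T /andP[iT T0]; rewrite /pshift; case: ifP => [dT|_]; last by rewrite mul0r.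
  move: T0; rewrite -finset.subset0; case/negP; apply/fintype.subsetP => k kT.
  have : k \in [set i1]%SET.
    move: dT; rewrite finset.disjoints_subset finset.setCK => /fintype.subsetP/(_ k).
    by rewrite !inE kT orbT => /(_ isT).
  by rewrite inE => /eqP ki; rewrite -ki kT in iT.
rewrite iE sE mxE /ptilde -/N -/pn; field; exact: hp.
Qed.

Lemma rcoef_sum_gt0 (F : {set 'I_n} -> R) :
  \sum_(T : {set 'I_n} | (T \subset N) && (0 < #|T|)%N) rcoef p (i1 |: T)%SET * F T =
  \sum_(T : {set 'I_n} | T \subset N) rcoef p (i1 |: T)%SET * F T.
Proof.
rewrite [RHS](bigD1 finset.set0) ?finset.sub0set//= finset.setU0 rcoef1 mul0r add0r.
by apply: eq_bigl => T; rewrite card_gt0.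
Qed.

End RCoefficients.

(** * The conditional Laplace transform *)

Section CondLaplace.
Context {R : realType} {n : nat} {d : measure_display} {T : measurableType d}.
Variables (mu : probability T R) (x : 'I_n -> T -> R).
Hypothesis mx : forall i, measurable_fun [set: T]%classic (x i).
Variables (p : {set 'I_n} -> R) (l : R) (i1 : 'I_n).
Hypotheses (l0 : 0 < l) (p0 : p finset.set0 = 1).
Local Open Scope classical_set_scope.
Implicit Types (theta : 'rV[R]_n).

Hypothesis orth : forall theta, (forall i, 0 <= theta 0 i) -> gamma_pt mu x p l theta.
Hypothesis x0 : {ae mu, forall w, 0 <= x i1 w}.
Hypothesis slope_gt0 : forall theta, (forall i, 0 <= theta 0 i) -> 0 < slope p theta i1.

Let p1 := p [set i1]%SET.

Lemma p1_gt0 : 0 < p1.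
Proof.
by rewrite /p1 -(slope0 p i1); apply: slope_gt0 => i; rewrite mxE.
Qed.

Lemma upd_ge0 theta s : (forall i, i != i1 -> 0 <= theta 0 i) -> 0 <= s ->
  forall i, 0 <= upd theta i1 s 0 i.
Proof. by move=> h s0 i; rewrite updE; case: eqP => // /eqP; exact: h. Qed.

Lemma SN_gt0 theta : (forall i, i != i1 -> 0 <= theta 0 i) -> 0 < SN p i1 theta.
Proof.
move=> h; rewrite SN_slope divr_gt0 ?p1_gt0// -(slope_upd p theta i1 0).
by apply: slope_gt0; exact: upd_ge0.
Qed.

(** On the first axis P is 1 + p1 s. Negative s are included because the shifted arguments in
    [cond_lt_exp_moment] can be negative. *)
Lemma marginal_extend s : 0 < 1 + p1 * s ->
  lapline mu (x i1) (others x 0 i1) s = ((1 + p1 * s) `^ (- l))%:E.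
Proof.
have e t : affine p (upd 0 i1 t) = 1 + p1 * t.
  have := affine_split p 0 i1; rewrite affine0 p0 mxE mulr0 addr0 => i0.
  by rewrite affine_upd slope0 -i0.
rewrite -e -lap_upd => ps.
have [|_ //] := @line_extend _ _ _ _ mu x mx p l l0 0 i1 0 1 ltr01 _ s ps.
move=> t /andP[t0 _]; apply: orth; apply: upd_ge0; last exact: ltW.
by move=> i _; rewrite mxE.
Qed.

Definition cond_lt (x1 : R) theta : R :=
  SN p i1 theta `^ (- l) *
  expR (- ((affine p (zero_at i1 theta) / SN p i1 theta - 1) * (x1 / p1))).

(** P(k, theta_N) factors as S (1 + p1 s) with s = k + (I / S - 1) / p1. Its power -l is thus S^(-l)
    times the marginal transform at s, and the shift s - k is the exponent in [cond_lt]. *)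
Lemma cond_lt_exp_moment theta (k : nat) : (forall i, i != i1 -> 0 <= theta 0 i) ->
  exp_moment mu (x i1) (fun w => cond_lt (x i1 w) theta) k =
  exp_moment mu (x i1) (fun w => expR (others x theta i1 w)) k.
Proof.
move=> h; have S0 := SN_gt0 h; have q0 := p1_gt0.
set S := SN p i1 theta in S0.
have hk : 0 <= k%:R :> R by [].
have [k0 kE] := orth (upd_ge0 h hk).
have [I0 _] := orth (upd_ge0 h (lexx 0)); rewrite -zero_at_upd in I0.
set I := affine p (zero_at i1 theta) in I0.
have affE : affine p (upd theta i1 k%:R) = S * (1 + p1 * (k%:R + (I / S - 1) / p1)).
  rewrite affine_upd /I zero_at_upd affine_upd mulr0 addr0.
  have -> : slope p theta i1 = S * p1 by rewrite /S SN_slope mulfVK// gt_eqF.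
  by field; rewrite !gt_eqF.
have pos : 0 < 1 + p1 * (k%:R + (I / S - 1) / p1).
  by move: k0; rewrite affE pmulr_rgt0.
have -> : exp_moment mu (x i1) (fun w => expR (others x theta i1 w)) k =
    lap mu x (upd theta i1 k%:R).
  rewrite lap_upd; apply: eq_integral => w _.
  by rewrite -expRD /tilt addrC.
rewrite kE affE powRM ?ltW// EFinM -marginal_extend//.
rewrite /lapline -ge0_integralZl//=; last 3 first.
- apply/measurable_EFinP; apply: measurable_tilt => //; exact: measurable_others.
- by move=> w _; rewrite lee_fin tilt_ge0.
- by rewrite lee_fin powR_ge0.
apply: eq_integral => w _; rewrite -EFinM; congr EFin.
rewrite /cond_lt -/S -/I mulrCA; congr (_ * _); rewrite -expRD /tilt; congr expR.
rewrite /others big1; last by move=> i _; rewrite mxE mul0r.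
by rewrite oppr0; field; rewrite !gt_eqF.
Qed.

Lemma cond_expectation theta : (forall i, i != i1 -> 0 <= theta 0 i) ->
  is_cond_expectation mu (fun w => expR (others x theta i1 w)) (x i1) (cond_lt ^~ theta).
Proof.
move=> h.
have mU : measurable_fun [set: T] (fun w => expR (others x theta i1 w)).
  by apply: measurableT_comp => //; exact: measurable_others.
have mg : measurable_fun [set: R] (cond_lt ^~ theta).
  apply: measurable_funM; first exact: measurable_cst.
  apply: measurableT_comp => //; apply: measurable_funN.
  apply: measurable_funM; first exact: measurable_cst.
  by apply: measurable_funM => //; exact: measurable_cst.
have fin k : (exp_moment mu (x i1) (fun w => expR (others x theta i1 w)) k < +oo)%E.
  have -> : exp_moment mu (x i1) (fun w => expR (others x theta i1 w)) k =
      lap mu x (upd theta i1 k%:R).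
    rewrite lap_upd; apply: eq_integral => w _.
    by rewrite -expRD /tilt addrC.
  have [_ ->] := orth (upd_ge0 h (ler0n R k)); exact: ltry.
split => //.
  have := integrable_exp_moment (mx i1) mU (fun w => expR_ge0 _) fin 0.
  by apply: eq_integrable => // w _ /=; rewrite mul0r oppr0 expR0 mul1r.
move=> B mB; apply: (laplace_unique (mx i1) x0) => //.
- exact: (measurableT_comp mg).
- by move=> w; rewrite mulr_ge0 ?powR_ge0 ?expR_ge0.
- by apply/funext => k; rewrite cond_lt_exp_moment.
Qed.

End CondLaplace.

(** * The conditional transform of a multivariate gamma vector and its closed forms *)

Unset Implicit Arguments.

Theorem theorem27 (R : realType) (n : nat) (hn : (2 <= n)%N)
    (lambda : R) (hlambda : 0 < lambda)
    (p : {set 'I_n} -> R)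
    (hp0 : p finset.set0 = 1)
    (hp : forall T : {set 'I_n}, p T != 0)
    (hpj : forall j : nat, (1 <= j <= n)%N ->
       0 < p [set i : 'I_n | (i < j)%N])
    (d : measure_display) (Omega : measurableType d) (Pr : probability Omega R)
    (X : {RV Pr >-> n.-tuple R})
    (hX : is_mvgamma (distribution Pr X) p lambda)
    (hdiv : mvgamma_infinitely_divisible p lambda)
    (hR : Rpoly p <> (fun _ : 'rV[R]_n => 0)) :
  let i1 : 'I_n := idx1 hn in
  let N : {set 'I_n} := [set~ i1] in
  let p1 : R := p [set i1] in
  let pn : R := p [set: 'I_n] in
  let S := SN p i1 in
  let L (x1 : R) (theta : 'rV[R]_n) : R :=
    S theta `^ (- lambda) *
    expR (- ((affine p (zero_at i1 theta) / S theta - 1) * (x1 / p1))) in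
  let C : R := \sum_(T : {set 'I_n} | (T \subset N) && (0 < #|T|)%N)
    rcoef p (i1 |: T) * monom (- thetaP p) (N :\: T) in
  [/\ is_cond_laplace X i1 L,
      forall (x1 : R) (theta : 'rV[R]_n), 0 < x1 ->
        (forall i, i \in N -> 0 <= theta 0 i) ->
        [/\ L x1 theta =
              S theta `^ (- lambda) *
              expR (- (((\sum_(T : {set 'I_n} | T \subset N)
                           (p T - p (i1 |: T) / p1) * monom theta T)
                        / S theta) * (x1 / p1))),
            L x1 theta =
              S theta `^ (- lambda) *
              expR (pn / p1 * x1 *
                \sum_(T : {set 'I_n} | (T \subset N) && (0 < #|T|)%N)
                  rcoef p (i1 |: T) * monom (- thetaP p) (N :\: T) *
                  (monom (Svec p theta) (N :\: T) * (S theta)^-1 - 1)) &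
            L x1 theta =
              S theta `^ (- lambda) *
              expR ((- ptilde p N)^-1 * x1 *
                ((\sum_(T : {set 'I_n} | (T \subset N) && (0 < #|T|)%N)
                    rcoef p (i1 |: T) * monom (- thetaP p) (N :\: T) *
                    monom (Svec p theta) (N :\: T) * (S theta)^-1) - C))],
      forall x1 : R, 0 < x1 -> L x1 0 = 1 &
      pn / p1 = (- ptilde p N)^-1].
Proof.
move=> i1 N p1 pn S L C.
pose x i w := tnth (X w) i.
have mx i : measurable_fun [set: Omega]%classic (x i).
  exact: (measurableT_comp (measurable_tnth i)).
have lapE theta : laplace (distribution Pr X) theta = lap Pr x theta.
  rewrite /laplace ge0_integral_distribution//.
  apply/measurable_EFinP; apply: measurableT_comp => //; apply: measurable_funN.
  apply: measurable_sum => i; apply: measurable_funM; first exact: measurable_cst.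
  exact: measurable_tnth.
have [A [[theta0 A0] HA]] := hX.
have g0 : gamma_nbhs Pr x p lambda theta0.
  by apply: filterS A0 => theta /HA[h1 h2]; split => //; rewrite -lapE.
have [orth xpos slp] := gamma_orthant mx hlambda hp0 hpj g0.
have slp1 (theta : 'rV[R]_n) : (forall i, 0 <= theta 0 i) -> 0 < slope p theta i1 by exact: slp.
have q0 : 0 < p1 by exact: p1_gt0 slp1.
have pn0 : pn != 0 by exact: hp.
have ptN : - ptilde p N = p1 / pn by rewrite /ptilde /N finset.setCK mulNr opprK.
have e4 : pn / p1 = (- ptilde p N)^-1 by rewrite ptN invf_div.
have NE (theta : 'rV[R]_n) : (forall i, i \in N -> 0 <= theta 0 i) ->
    forall i, i != i1 -> 0 <= theta 0 i.
  by move=> h i ii; apply: h; rewrite !inE.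
(* The term T = {1} is zero, so restoring it gives the full Taylor sum of [rcoef_sum]. *)
have sum1 theta : \sum_(T : {set 'I_n} | (T \subset N) && (0 < #|T|)%N)
    rcoef p (i1 |: T) * monom (- thetaP p) (N :\: T) * monom (Svec p theta) (N :\: T)
    = - pn^-1 * (affine p (zero_at i1 theta) + p1 * S theta * ptilde p [set i1]).
  rewrite (eq_bigr (fun T => rcoef p (i1 |: T)%SET *
    (monom (- thetaP p) (N :\: T)%SET * monom (Svec p theta) (N :\: T)%SET))); last first.
    by move=> T _; rewrite mulrA.
  rewrite (rcoef_sum_gt0 i1 hp) (eq_bigr _ (fun T _ => mulrA _ _ _)) rcoef_sum//.
  rewrite zero_at_upd affine_upd mulr0 addr0 /S SN_slope -/pn -/p1.
  by congr (_ * (_ + _ * _)); rewrite mulrC mulfVK// gt_eqF.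
have S0 : S 0 = 1 by rewrite /S SN_slope slope0 divff// hp.
have z0 : zero_at i1 (0 : 'rV[R]_n) = 0.
  by apply/rowP => i; rewrite !mxE; case: ifP.
(* C is the preceding sum at theta = 0, where every S_i equals 1. *)
have CE : C = - pn^-1 * (1 + p1 * ptilde p [set i1]).
  have := sum1 0; rewrite S0 z0 affine0 hp0 mulr1 => <-; apply: eq_bigr => T _.
  rewrite [X in _ = _ * X]big1 ?mulr1// => i _.
  by rewrite !mxE mulr0 addr0.
split => //.
- move=> theta h.
  have -> : (fun w => expR (- \sum_(i in [set~ i1]) theta 0 i * tnth (X w) i)) =
      (fun w => expR (others x theta i1 w)).
    by apply/funext => w; congr (expR (- _)); apply: eq_bigl => i; rewrite !inE.
  exact: (cond_expectation mx hlambda hp0 orth (xpos i1) slp1 (NE theta h)).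
- move=> x1 theta x10 h; have Sth : 0 < S theta := SN_gt0 slp1 (NE theta h).
  have e3 : L x1 theta = S theta `^ (- lambda) * expR ((- ptilde p N)^-1 * x1 *
      ((\sum_(T : {set 'I_n} | (T \subset N) && (0 < #|T|)%N)
          rcoef p (i1 |: T) * monom (- thetaP p) (N :\: T) *
          monom (Svec p theta) (N :\: T) * (S theta)^-1) - C)).
    (* The terms p1 ptilde_1 of the sum divided by S and of C cancel, leaving -(P(0, theta_N) / S -
       1) x1 / p1. *)
    congr (_ * expR _); rewrite -mulr_suml sum1 CE -e4.
    by field; rewrite pn0 !gt_eqF.
  have e1 : affine p (zero_at i1 theta) / S theta - 1 =
      (\sum_(T : {set 'I_n} | T \subset N) (p T - p (i1 |: T) / p1) * monom theta T)
        / S theta.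
    have -> : affine p (zero_at i1 theta) =
        \sum_(T : {set 'I_n} | T \subset N) p T * monom theta T.
      rewrite zero_at_upd affine_upd mulr0 addr0 /intercept.
      by apply: eq_bigl => T; rewrite subC1.
    rewrite -(@divff _ (S theta)) ?gt_eqF// -mulrBl; congr (_ / _).
    rewrite /S /SN -sumrB; apply: eq_bigr => T _.
    by rewrite mulrBl.
  split => //.
  + by rewrite /L e1.
  + rewrite e3 -e4; congr (_ * expR (_ * _)).
    rewrite /C -sumrB; apply: eq_bigr => T _; ring.
- by move=> x1 _; rewrite /L S0 z0 affine0 hp0 divr1 subrr mul0r oppr0 expR0 powR1 mulr1.
Qed.
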